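(* Let $n,d\ge1$ be integers. If $E\subset\mathbb{R}^d$ is $n$-rectifiable and has finite $n$-packing content, then for $\mathcal{H}^n$-a.e. $x\in E$ there exists an $n$-plane $V_x$ such that $\mathrm{Tan}_{\mathrm{AW}}(E,x)=\{V_x\}$.
   Context: Hausdorff measure: $\mathcal{H}^s(A)=\lim_{\delta\to0}\inf\{\sum_i(\operatorname{diam}U_i)^s: A\subset\bigcup_iU_i,\ \operatorname{diam}U_i\le\delta\}$. A metric space $Y$ is $n$-rectifiable if there are countably many Lipschitz maps $f_i:E_i\to Y$, $E_i\subset[0,1]^n$, with $\mathcal{H}^n(Y\setminus\bigcup_if_i(E_i))=0$. A metric space $Y$ has finite $s$-packing content if there is $M\in(0,\infty)$ such that $\sum_ir(B_i)^s<M$ for every countable collection of mutually disjoint closed balls $B_i\subset Y$ (centered in $Y$) with radii $r(B_i)\le\operatorname{diam}Y$. Subsets of $\mathbb{R}^d$ are regarded as metric spaces with the Euclidean metric. For nonempty sets $A,B$ in a metric space $Z$, $\mathrm{ex}(A,B)=\sup_{a\in A}\inf_{b\in B}d_Z(a,b)$, $\mathrm{ex}(\emptyset,B)=0$, and $\mathrm{D}^{z,r}[A,B]=r^{-1}\max\{\mathrm{ex}(A\cap B_Z(z,r),B),\mathrm{ex}(B\cap B_Z(z,r),A)\}$, with $B_Z(z,r)$ the closed ball. For $x\in E\subset\mathbb{R}^d$, $\mathrm{Tan}_{\mathrm{AW}}(E,x)$ is the set of all closed $T\subset\mathbb{R}^d$ with $\mathbf{0}\in T$ for which there is a sequence of positive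 numbers $r_i\to0$ with $\lim_i\mathrm{D}^{\mathbf{0},R}[r_i^{-1}(E-x),T]=0$ for every $R>0$ (for closed $E$ this is convergence in the Attouch-Wets topology). An $n$-plane is an $n$-dimensional plane in $\mathbb{R}^d$ (tangent planes contain $\mathbf{0}$). *)

(* Defs.v *)
From HB Require Import structures.
From mathcomp Require Import all_boot all_order all_algebra.
From mathcomp Require Import all_classical all_reals all_analysis.
From mathcomp Require Import ring.

Set Implicit Arguments.
Unset Strict Implicit.
Unset Printing Implicit Defensive.

Import Order.TTheory GRing.Theory Num.Theory.
Import numFieldNormedType.Exports.

Local Open Scope classical_set_scope.
Local Open Scope ring_scope.

(* The library's metric on ['rV[R]_d] is the sup metric; [euclid R d] is a copy
   of this vector space that carries the Euclidean metric and its topology. *)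
Definition euclid (R : realType) (d : nat) : Type := 'rV[R]_d.

HB.instance Definition _ (R : realType) (d : nat) :=
  Vector.on (euclid R d).

Definition eucl_dist (R : realType) (d : nat) (x y : euclid R d) : R :=
  Num.sqrt (\sum_(i < d) (x ord0 i - y ord0 i) ^+ 2).

Section euclid_metric.
Context (R : realType) (d : nat).
Implicit Types (x y z : euclid R d) (u v : 'I_d -> R).

Lemma eucl_distxx x : eucl_dist x x = 0.
Proof.
rewrite /eucl_dist big1 ?sqrtr0// => i _.
by rewrite subrr expr0n.
Qed.

Lemma eucl_dist_positivity x y : eucl_dist x y = 0 -> x = y.
Proof.
move=> /eqP; rewrite /eucl_dist sqrtr_eq0 => h.
have h0 : \sum_(i < d) (x ord0 i - y ord0 i) ^+ 2 = 0.
  by apply/eqP; rewrite eq_le h/= sumr_ge0// => i _; rewrite sqr_ge0.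
apply/rowP => i; apply/eqP; rewrite -subr_eq0 -sqrf_eq0; apply/eqP.
by apply: (psumr_eq0P _ h0) => // j _; rewrite sqr_ge0.
Qed.

Lemma eucl_dist_sym x y : eucl_dist x y = eucl_dist y x.
Proof.
by rewrite /eucl_dist; congr Num.sqrt; apply: eq_bigr => i _;
  rewrite -sqrrN opprB.
Qed.

Lemma sum_cauchy_schwarz u v :
  (\sum_i u i * v i) ^+ 2 <= (\sum_i u i ^+ 2) * (\sum_i v i ^+ 2).
Proof.
set a := \sum_i u i ^+ 2; set b := \sum_i v i ^+ 2; set c := \sum_i u i * v i.
have a0 : 0 <= a by apply: sumr_ge0 => i _; rewrite sqr_ge0.
have [a00|aneq0] := eqVneq a 0.
  have u0 i : u i = 0.
    apply/eqP; rewrite -sqrf_eq0; apply/eqP.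
    by apply: (psumr_eq0P _ a00) => // j _; rewrite sqr_ge0.
  rewrite a00 mul0r /c big1 ?expr0n// => i _.
  by rewrite u0 mul0r.
have : 0 <= \sum_i (a * v i - c * u i) ^+ 2.
  by apply: sumr_ge0 => i _; rewrite sqr_ge0.
have -> : \sum_i (a * v i - c * u i) ^+ 2 = a * (a * b - c ^+ 2).
  transitivity (\sum_i (a ^+ 2 * v i ^+ 2 - (2 * a * c) * (u i * v i)
                        + c ^+ 2 * u i ^+ 2)).
    by apply: eq_bigr => i _; ring.
  rewrite big_split/= sumrB -!mulr_sumr -/a -/b -/c; ring.
by rewrite pmulr_rge0 ?subr_ge0// lt_neqAle eq_sym aneq0.
Qed.

Lemma eucl_dist_triangle y x z : eucl_dist x z <= eucl_dist x y + eucl_dist y z.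
Proof.
pose u i := x ord0 i - y ord0 i; pose v i := y ord0 i - z ord0 i.
have uv : \sum_(i < d) (x ord0 i - z ord0 i) ^+ 2 =
    \sum_i u i ^+ 2 + 2 * \sum_i u i * v i + \sum_i v i ^+ 2.
  rewrite mulr_sumr -!big_split/=; apply: eq_bigr => i _; rewrite /u /v; ring.
have u0 : 0 <= \sum_i u i ^+ 2 by apply: sumr_ge0 => i _; rewrite sqr_ge0.
have v0 : 0 <= \sum_i v i ^+ 2 by apply: sumr_ge0 => i _; rewrite sqr_ge0.
rewrite /eucl_dist -/u -/v uv -[leRHS]ger0_norm ?addr_ge0 ?sqrtr_ge0//.
rewrite -sqrtr_sqr ler_wsqrtr// sqrrD !sqr_sqrtr// lerD2r lerD2l.
rewrite -[leRHS]mulr_natl ler_wpM2l//.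
apply: le_trans (ler_norm _) _; rewrite -sqrtr_sqr -sqrtrM// ler_wsqrtr//.
exact: sum_cauchy_schwarz.
Qed.

HB.instance Definition _ := @isMetric.Build R (euclid R d) (@eucl_dist R d)
  eucl_distxx eucl_dist_positivity eucl_dist_sym eucl_dist_triangle.

End euclid_metric.

(* The points of [E] with the restricted distance. *)
Definition submetric (R : realType) (T : metricType R) (E : set T) : Type :=
  {x : T | x \in E}.

Section submetric_metric.
Context (R : realType) (T : metricType R) (E : set T).

HB.instance Definition _ := Choice.on (submetric E).

Definition subdist (x y : submetric E) : R := mdist (val x) (val y).

Let subdistxx x : subdist x x = 0. Proof. exact: mdistxx. Qed.

Let subdist_positivity x y : subdist x y = 0 -> x = y.
Proof. by move=> /mdist_positivity /val_inj. Qed.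

Let subdist_sym x y : subdist x y = subdist y x.
Proof. exact: metric_sym. Qed.

Let subdist_triangle y x z : subdist x z <= subdist x y + subdist y z.
Proof. exact: metric_triangle. Qed.

HB.instance Definition _ := @isMetric.Build R (submetric E) subdist
  subdistxx subdist_positivity subdist_sym subdist_triangle.

End submetric_metric.

Section metric_notions.
Context (R : realType).
Local Open Scope ereal_scope.

(* [ereal_sup set0 = -oo]: [maxe 0] only matters for the empty set, which gets
   diameter 0. *)
Definition diam (T : metricType R) (U : set T) : \bar R :=
  maxe 0 (ereal_sup [set (mdist x y)%:E | x in U & y in U]).

(* Finite covers are included, as the [U i] may be empty (for [s != 0]). *)
Definition hausdorff_content (T : metricType R) (s : R) (A : set T)
    (delta : R) : \bar R :=
  ereal_inf [set \sum_(0 <= i <oo) (diam (U i) `^ s) | U in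
    [set U : nat -> set T | A `<=` \bigcup_i U i /\
                            forall i, diam (U i) <= delta%:E]].

Definition hausdorff_measure (T : metricType R) (s : R) (A : set T) : \bar R :=
  lim (hausdorff_content s A delta @[delta --> 0^'+]).

Definition lipschitz_map (X Y : metricType R) (f : X -> Y) : Prop :=
  exists L : R, forall x y, (mdist (f x) (f y) <= L * mdist x y)%R.

Definition unit_cube (n : nat) : set (euclid R n) :=
  [set x | forall j : 'I_n, (0 <= x ord0 j <= 1)%R].

Definition rectifiable (n : nat) (Y : metricType R) : Prop :=
  exists (Es : nat -> set (euclid R n)) (f : forall i, submetric (Es i) -> Y),
    [/\ forall i, Es i `<=` @unit_cube n,
        forall i, lipschitz_map (f i) &
        hausdorff_measure n%:R (~` \bigcup_i range (f i)) = 0].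

(* The library's [closed_ball] is the closure of the open ball, which can be
   smaller than this set in a general metric space. *)
Definition cball (T : metricType R) (z : T) (r : R) : set T :=
  [set y | (mdist z y <= r)%R].

(* A countable family of balls is indexed by a subset [I] of [nat]. *)
Definition finite_packing_content (s : R) (Y : metricType R) : Prop :=
  exists M : R, (0 < M)%R /\
    forall (I : set nat) (c : nat -> Y) (r : nat -> R),
      (forall i, I i -> (0 < r i)%R /\ (r i)%:E <= diam [set: Y]) ->
      trivIset I (fun i => cball (c i) (r i)) ->
      \esum_(i in I) ((r i) `^ s)%:E < M%:E.

(* [maxe 0] encodes [excess set0 B = 0]. *)
Definition excess (Z : metricType R) (A B : set Z) : \bar R :=
  maxe 0 (ereal_sup
    [set ereal_inf [set (mdist a b)%:E | b in B] | a in A]).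

Definition rel_dist (Z : metricType R) (z : Z) (r : R) (A B : set Z) : \bar R :=
  (r^-1)%:E * maxe (excess (A `&` cball z r) B) (excess (B `&` cball z r) A).

Definition blowup (d : nat) (E : set (euclid R d)) (x : euclid R d) (r : R) :
    set (euclid R d) :=
  [set r^-1 *: (y - x) | y in E]%R.

Definition TanAW (d : nat) (E : set (euclid R d)) (x : euclid R d) :
    set (set (euclid R d)) :=
  [set T | [/\ closed T, T 0%R &
    exists r : nat -> R,
      [/\ forall i, (0 < r i)%R, r @ \oo --> (0 : R)%R &
          forall rho : R, (0 < rho)%R ->
            rel_dist (0%R : euclid R d) rho (blowup E x (r i)) T
              @[i --> \oo] --> 0]]].

End metric_notions.

(* Main.v *)
Require Import Defs.
From mathcomp Require Import all_boot all_order all_algebra.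
From mathcomp Require Import all_classical all_reals all_analysis.
From mathcomp Require Import ring lra zify.

(** A point [x] of any subset [F] of a set [P] with finite packing content is,
    outside an [H^n]-null set, a point of density: [dist (y, F) = o(|x - y|)] for
    [y] in [P]. Indeed the balls [B(y, dist (y, F) / 4)] have a maximal disjoint
    subfamily, bad points lie in infinitely many of their dilates, and the packing
    bound makes Borel-Cantelli apply. With [P = E], the tangents of [E] at almost
    every point of [F] are those of [F], so [E] can be cut into countably many
    bi-Lipschitz pieces [F = f(A)]; with [P] the unit cube, [A] is dense enough
    near almost every point for the blow-ups of [f(A)] to fill the range of the
    differential.

    Rademacher's theorem comes from the same principle: the mean slopes of a
    Lipschitz function over dyadic cubes form a bounded martingale, which
    converges almost everywhere by orthogonality of increments, and near points
    of density of the set where it has almost converged every cube crossed by a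
    coordinate walk from [x] to [y] has nearly the limiting slope. Critical
    values are null by covering images of dyadic cubes. *)

Set Implicit Arguments.
Unset Strict Implicit.
Unset Printing Implicit Defensive.

Import Order.TTheory GRing.Theory Num.Theory.
Import numFieldNormedType.Exports.

Local Open Scope classical_set_scope.
Local Open Scope ring_scope.

(** * Null sets *)

(** The pieces into which sets are cut are arbitrary, so density is expressed by distances and not
    by the measure of balls; the packing bound supplies the summability behind every
    almost-everywhere statement. The parameter space carries the sup norm, whose balls are cubes,
    and smallness is that of the sum of [n]-th powers over a cover; Euclidean distances return in
    the target, at the price of a factor [d].

    Blow-ups of a piece follow the range of the differential only if nearness of [f(z)] to [f(x)]
    forces nearness of [z] to [x], hence the need for an injective differential and a lower
    Lipschitz bound. Points where the differential has a kernel may fill a large part of the domain;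
    it is their images that are null, so the exceptional sets are collected in the target.

    Means of a Lipschitz function are limits of Riemann sums along an ultrafilter: the martingale
    identity is algebraic at each fine mesh and survives in the limit, so the volume of a dyadic
    cube enters only as the weight of a word. *)

Lemma ler_sum_subset (R : realType) (I : eqType) (F : I -> R) (s t : seq I) :
  (forall i, 0 <= F i) -> uniq s -> {subset s <= t} ->
  \sum_(i <- s) F i <= \sum_(i <- t) F i.
Proof.
move=> F0; elim: s t => [|x s IH] t /=; first by rewrite big_nil sumr_ge0.
case/andP => xs us st.
have xt : x \in t by apply: st; rewrite inE eqxx.
rewrite (perm_big _ (perm_to_rem xt)) !big_cons lerD2l IH// => y ys.
have yx : y != x by apply: contraNneq xs => <-.
by have := st y; rewrite inE ys orbT (perm_mem (perm_to_rem xt)) inE (negPf yx) => /(_ isT).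
Qed.

Lemma sum_half_pow_le (R : realType) (e : R) N : 0 <= e ->
  \sum_(k < N) e / 2 ^+ k.+1 <= e.
Proof.
move=> e0; suff -> : \sum_(k < N) e / 2 ^+ k.+1 = e - e / 2 ^+ N.
  by rewrite gerBl divr_ge0// exprn_ge0.
elim: N => [|N IH]; first by rewrite big_ord0 expr0 divr1 subrr.
rewrite big_ord_recr /= IH exprS.
have : (2 : R) ^+ N != 0 by rewrite expf_neq0.
by move=> h; field.
Qed.

Section null_sets.
Context (R : realType) (n : nat) (n_gt0 : (0 < n)%N).

(** Nullity for the [n]-dimensional Hausdorff measure, over a bare distance function so that sup,
    Euclidean and restricted distances are treated alike. Each [r i] is only a bound for a diameter,
    and no mesh size appears: a small sum forces every [r i] to be small. *)
Definition null (T : Type) (d : T -> T -> R) (A : set T) :=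
  forall e : R, 0 < e -> exists (U : nat -> set T) (r : nat -> R),
    [/\ forall i, 0 <= r i,
        forall i x y, U i x -> U i y -> d x y <= r i,
        A `<=` \bigcup_i U i &
        forall N, \sum_(i < N) r i ^+ n <= e].

Section one_space.
Context (T : Type) (d : T -> T -> R).

Lemma sub_null A B : A `<=` B -> null d B -> null d A.
Proof.
move=> AB nB e /nB[U [r [r0 dU BU sr]]]; exists U, r; split => //.
exact: subset_trans BU.
Qed.

(** Bounds on sums over duplicate-free lists encode summability over a countable family. Numbers
    that code no index of [S] receive the empty set and radius 0, which adds [0 ^+ n = 0] because
    [n] is positive. *)
Lemma cover_of_countable (I : choiceType) (S : set I) (U : I -> set T)
    (r : I -> R) (A : set T) (e : R) :
  countable S -> (forall i, S i -> 0 <= r i) ->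
  (forall i x y, S i -> U i x -> U i y -> d x y <= r i) ->
  A `<=` \bigcup_(i in S) U i ->
  (forall s : seq I, uniq s -> (forall i, i \in s -> S i) ->
     \sum_(i <- s) r i ^+ n <= e) ->
  exists (V : nat -> set T) (q : nat -> R),
    [/\ forall i, 0 <= q i,
        forall i x y, V i x -> V i y -> d x y <= q i,
        A `<=` \bigcup_i V i &
        forall N, \sum_(i < N) q i ^+ n <= e].
Proof.
move=> cS r0 dU AU sr.
have [f finj] : exists f : I -> nat, {in S &, injective f}.
  by have /countable_injP[f fI] := cS; exists f; exact: fI.
pose g k : option I :=
  if pselect (exists i, S i /\ f i = k) is left h then Some (projT1 (cid h))
  else None.
have gP k i : g k = Some i -> S i /\ f i = k.
  by rewrite /g; case: pselect => // h [<-]; exact: (projT2 (cid h)).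
have gf i : S i -> g (f i) = Some i.
  move=> Si; rewrite /g; case: pselect => [h|[]]; last by exists i.
  by congr Some; have [Sj fj] := projT2 (cid h); apply: finj; rewrite ?inE.
have gK : ocancel g f.
  by move=> k; case E : (g k) => [i|] //=; have [] := gP _ _ E.
exists (fun k => if g k is Some i then U i else set0),
       (fun k => if g k is Some i then r i else 0); split.
- by move=> k; case E : (g k) => [i|] //; apply: r0; have [] := gP _ _ E.
- by move=> k x y; case E : (g k) => [i|] //; apply: dU; have [] := gP _ _ E.
- by move=> x /AU[i Si Uix]; exists (f i) => //; rewrite gf.
- move=> N; rewrite -(big_mkord xpredT (fun k => (if g k is Some i then r i else 0) ^+ n)).
  have -> : \sum_(0 <= k < N) (if g k is Some i then r i else 0) ^+ n =
     \sum_(i <- pmap g (index_iota 0 N)) r i ^+ n.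
    elim: (index_iota 0 N) => [|k s IH]; first by rewrite !big_nil.
    rewrite big_cons /= IH; case: (g k) => [i|] /=; first by rewrite big_cons.
    by rewrite expr0n eqn0Ngt n_gt0 add0r.
  apply: sr; first by rewrite (pmap_uniq gK)// iota_uniq.
  move=> i; rewrite mem_pmap => /mapP[k _ /esym E].
  by have [] := gP _ _ E.
Qed.

(** For each [k], at most [M * k.+1%:R] indices satisfy [k.+1%:R^-1 < r i ^+ n], and every index of
    [S] does so for some [k]. *)
Lemma countable_of_bounded_sums (I : choiceType) (S : set I) (r : I -> R) (M : R) :
  (forall i, S i -> 0 < r i) ->
  (forall s : seq I, uniq s -> (forall i, i \in s -> S i) ->
     \sum_(i <- s) r i ^+ n <= M) ->
  countable S.
Proof.
move=> r0 sr.
pose Sk (k : nat) := [set i | S i /\ k.+1%:R^-1 < r i ^+ n].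
have -> : S = \bigcup_k Sk k.
  apply/seteqP; split=> [i Si|i [k _ []//]].
  have rn : 0 < (r i ^+ n) by rewrite exprn_gt0 ?r0.
  have [k hk] := ltr_add_invr rn; exists k => //; split => //.
  by rewrite add0r in hk.
apply: bigcup_countable => // k _; apply: finite_set_countable.
apply: contrapT => infS.
have [K hK] : exists K : nat, M * k.+1%:R < K%:R.
  by exists (Num.truncn (`|M * k.+1%:R|)).+1; apply: le_lt_trans (ler_norm _) _; exact: truncnS_gt.
have [X /= XS cX] := infinite_set_fset K infS.
have := sr (finmap.enum_fset X) (finmap.fset_uniq X).
have /[swap]/[apply] : forall i, i \in finmap.enum_fset X -> S i by move=> i /XS[].
apply/negP; rewrite -ltNge.
apply: lt_le_trans (_ : K%:R / k.+1%:R <= _); first by rewrite ltr_pdivlMr.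
apply: le_trans (_ : (size (finmap.enum_fset X))%:R / k.+1%:R <= _).
  by rewrite ler_pM2r ?invr_gt0// ler_nat.
have -> : (size (finmap.enum_fset X))%:R / k.+1%:R =
   \sum_(i <- finmap.enum_fset X) k.+1%:R^-1 :> R.
  by rewrite big_const_seq count_predT iter_addr_0 mulr_natl.
rewrite big_seq [leRHS]big_seq; apply: ler_sum => i /XS[_ /ltW]//.
Qed.

Lemma null_bigcup (A : nat -> set T) :
  (forall k, null d (A k)) -> null d (\bigcup_k A k).
Proof.
move=> nA e e0.
have /choice[U hU] k : exists Ur : (nat -> set T) * (nat -> R),
    [/\ forall i, 0 <= Ur.2 i,
        forall i x y, Ur.1 i x -> Ur.1 i y -> d x y <= Ur.2 i,
        A k `<=` \bigcup_i Ur.1 i &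
        forall N, \sum_(i < N) Ur.2 i ^+ n <= e / 2 ^+ k.+1].
  have ek : 0 < e / 2 ^+ k.+1 by rewrite divr_gt0// exprn_gt0.
  by have [U [r h]] := nA k _ ek; exists (U, r).
apply: (@cover_of_countable (nat * nat)%type setT (fun p => (U p.1).1 p.2)
  (fun p => (U p.1).2 p.2)) => //.
- exact: countableP.
- by move=> [k i] _ /=; case: (hU k).
- by move=> [k i] x y _ /=; case: (hU k) => _ + _ _; apply.
- move=> x [k _ Akx]; case: (hU k) => _ _ /(_ _ Akx)[i _ Ux] _.
  by exists (k, i).
- move=> s us _.
  (* A finite list of pairs sits in a square, which is summed row by row. *)
  pose K := (\max_(p <- s) maxn p.1 p.2).+1.
  pose t := [seq (k, i) | k <- index_iota 0 K, i <- index_iota 0 K].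
  apply: le_trans (_ : \sum_(p <- t) (U p.1).2 p.2 ^+ n <= _).
    apply: ler_sum_subset => //.
      by move=> [k i] /=; rewrite exprn_ge0//; case: (hU k).
    move=> [k i] ps; apply/allpairsP; exists (k, i).
    have : (maxn k i < K)%N.
      by rewrite ltnS; exact: (@leq_bigmax_seq _ s xpredT (fun p : nat * nat => maxn p.1 p.2) (k, i)).
    by rewrite gtn_max => /andP[kK iK]; rewrite !mem_index_iota.
  rewrite /t big_allpairs /=.
  apply: le_trans (sum_half_pow_le K (ltW e0)).
  rewrite -(big_mkord xpredT (fun k => e / 2 ^+ k.+1)).
  apply: ler_sum => k _; rewrite big_mkord; by case: (hU k).
Qed.

Lemma nullU A B : null d A -> null d B -> null d (A `|` B).
Proof.
move=> nA nB; rewrite -bigcup2E; apply: null_bigcup => -[|[|k]]//=.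
by move=> e e0; apply: sub_null nA _ e0; exact: sub0set.
Qed.

(** Borel-Cantelli; lying in infinitely many [B i] is expressed by escaping every finite list. Once
    the sum over a list [s] is within [e] of the supremum of all finite sums, the indices outside
    [s] have finite sums at most [e], and their sets still cover. *)
Lemma null_limsup (I : choiceType) (S : set I) (B : I -> set T) (r : I -> R)
    (M : R) :
  (forall i, S i -> 0 < r i) ->
  (forall s : seq I, uniq s -> (forall i, i \in s -> S i) ->
     \sum_(i <- s) r i ^+ n <= M) ->
  (forall i x y, S i -> B i x -> B i y -> d x y <= r i) ->
  null d [set x | forall s : seq I, exists i, [/\ S i, i \notin s & B i x]].
Proof.
move=> r0 sr dB e e0.
pose X := [set x : R | exists s : seq I,
  [/\ uniq s, (forall i, i \in s -> S i) & x = \sum_(i <- s) r i ^+ n]].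
have hX : has_sup X.
  split; first by exists 0, [::]; rewrite big_nil.
  by exists M => _ [s [us sS ->]]; exact: sr.
have [_ [s [us sS ->]] hs] := sup_adherent e0 hX.
apply: (@cover_of_countable _ [set i | S i /\ i \notin s] B r).
- apply: (@countable_of_bounded_sums _ _ r M); first by move=> i [/r0].
  by move=> t ut tS; apply: sr => // i /tS[].
- by move=> i [/r0/ltW].
- by move=> i x y [Si _]; exact: dB.
- by move=> x /(_ s)[i [Si ins Bx]]; exists i.
- move=> t ut tS.
  have : \sum_(i <- s ++ t) r i ^+ n <= sup X.
    apply: sup_upper_bound => //; exists (s ++ t); split => //.
      rewrite cat_uniq us ut andbT /=; apply/hasPn => i /tS[_ /=].
      by [].
    by move=> i; rewrite mem_cat => /orP[/sS|/tS[]].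
  rewrite big_cat /= => h; lra.
Qed.

End one_space.

Lemma null_image (S T : Type) (dS : S -> S -> R) (dT : T -> T -> R)
    (f : S -> T) (L : R) (A : set S) :
  (forall x y, 0 <= dS x y) ->
  (forall x y, A x -> A y -> dT (f x) (f y) <= L * dS x y) ->
  null dS A -> null dT (f @` A).
Proof.
move=> dS0 fL nA e e0.
(* Positive even if [L] is not, so that [e] can be divided by [K ^+ n]. *)
pose K := `|L| + 1.
have K0 : 0 < K by rewrite ltr_wpDl.
have eK : 0 < e / K ^+ n by rewrite divr_gt0 ?exprn_gt0.
have [U [r [r0 dU AU sr]]] := nA _ eK.
exists (fun i => f @` (A `&` U i)), (fun i => K * r i); split.
- by move=> i; rewrite mulr_ge0// ltW.
- move=> i _ _ [x [Ax Ux] <-] [y [Ay Uy] <-].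
  apply: le_trans (fL _ _ Ax Ay) _.
  apply: le_trans (_ : K * dS x y <= _); last by rewrite ler_pM2l// dU.
  by rewrite ler_wpM2r// (le_trans (ler_norm _))// lerDl.
- by move=> _ [x Ax <-]; have [i _ Ux] := AU _ Ax; exists i => //; exists x.
- move=> N; under eq_bigr do rewrite exprMn.
  by rewrite -mulr_sumr mulrC -ler_pdivlMr ?exprn_gt0.
Qed.

End null_sets.

(** * Density points *)

Section porosity.
Context (R : realType) (n : nat) (n_gt0 : (0 < n)%N).
Context (T : choiceType) (d : T -> T -> R).
Hypothesis dxx : forall x, d x x = 0.
Hypothesis d_ge0 : forall x y, 0 <= d x y.
Hypothesis dC : forall x y, d x y = d y x.
Hypothesis d_triangle : forall y x z, d x z <= d x y + d y z.

Definition dense_at (P F : set T) (x : T) := forall e : R, 0 < e ->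
  exists2 del : R, 0 < del & forall y, P y -> d x y < del ->
    exists2 z, F z & d y z <= e * d x y.

Definition bounded_packing (P : set T) (M : R) :=
  forall (s : seq T) (r : T -> R), uniq s ->
    (forall x, x \in s -> [/\ P x, 0 < r x &
       exists p q, [/\ P p, P q & r x <= d p q]]) ->
    (forall x y z, x \in s -> y \in s -> x != y -> P z ->
       d x z <= r x -> d y z <= r y -> False) ->
    \sum_(x <- s) r x ^+ n <= M.

Let gap (F : set T) y := inf [set d y z | z in F].

Lemma gap_le F y z : F z -> gap F y <= d y z.
Proof.
move=> Fz; apply: inf_lbound; last by exists z.
by exists 0 => _ [w _ <-].
Qed.

Lemma le_gap F y e x : F x -> (forall z, F z -> e <= d y z) -> e <= gap F y.
Proof.
move=> Fx h; apply: lb_le_inf; first by exists (d y x), x.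
by move=> _ [z Fz <-]; exact: h.
Qed.

Lemma gap_triangle F x y y' : F x -> gap F y <= d y y' + gap F y'.
Proof.
move=> Fx; rewrite -lerBlDl; apply: (le_gap Fx) => z Fz.
rewrite lerBlDl; exact: le_trans (gap_le _ Fz) (d_triangle _ _ _).
Qed.

(* The balls [B(y, gap F y / 4)] of a maximal disjoint family have comparable
   radii whenever they meet, so a bad point of [F] lies in infinitely many of
   their dilates, whose radii have a summable [n]-th power. *)
Lemma null_not_dense_at (P F : set T) (M : R) :
  bounded_packing P M -> F `<=` P ->
  null n d [set x | F x /\ ~ dense_at P F x].
Proof.
move=> PM FP.
pose D := [set y | P y /\ 0 < gap F y].
pose B y := [set z | P z /\ d y z <= gap F y / 4].
have [S [SD tS Smax]] := ex_maximal_disjoint_subcollection B D.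
have Sum s : uniq s -> (forall y, y \in s -> S y) ->
    (exists x, F x) -> \sum_(y <- s) (gap F y / 4) ^+ n <= M.
  move=> us sS [x0 Fx0]; apply: PM => //.
    move=> y /sS/SD[Py gy]; split => //; first by rewrite divr_gt0.
    exists y, x0; split => //; first exact: FP.
    by apply: le_trans (gap_le y Fx0); lra.
  move=> x y z /sS Sx /sS Sy /eqP xy Pz xz yz; apply: xy.
  by apply: tS => //; exists z.
have meet y : D y -> exists s, [/\ S s & exists z, B s z /\ B y z].
  move=> Dy; have [Sy|Sy] := pselect (S y).
    exists y; split => //; exists y; case: (Dy) => Py gy.
    by do 2!split => //; rewrite dxx divr_ge0// ltW.
  apply: contrapT => h.
  apply: (Smax (S `|` [set y])).
  - split; first by move=> z; left.
    by move=> /(_ y (or_intror erefl)).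
  - by move=> z [/SD//|->].
  - move=> i j [Si|->] [Sj|->] [z [Bi Bj]] //.
    + by apply: tS => //; exists z.
    + by exfalso; apply: h; exists i; split => //; exists z.
    + by exfalso; apply: h; exists j; split => //; exists z.
pose bad (k : nat) := [set x | F x /\ forall del : R, 0 < del ->
  exists y, [/\ P y, d x y < del & forall z, F z -> k.+1%:R^-1 * d x y < d y z]].
suff nb k : null n d (bad k).
  apply: sub_null (null_bigcup n_gt0 nb) => x [Fx nd].
  move/existsNP : nd => [e /not_implyP[e0 nd]].
  have [k hk] := ltr_add_invr e0; rewrite add0r in hk.
  exists k => //; split => // del del0.
  apply: contrapT => h; apply: nd; exists del => // y Py dxy.
  apply: contrapT => h2; apply: h; exists y; split => // z Fz.
  rewrite ltNge; apply/negP => dyz; apply: h2; exists z => //.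
  by apply: le_trans dyz _; rewrite ler_wpM2r// ltW.
(* If the quarter balls of [i] and [y] meet, then [gap F y <= 2 * gap F i] and [d i y <= gap F i].
   With [d x y <= k.+1%:R * gap F y], the point [x] is within [(2 * k.+1%:R + 1) * gap F i = K *
   (gap F i / 4)] of [i]. *)
pose K : R := 8 * k.+1%:R + 4.
have K0 : 0 < K by rewrite addr_gt0// mulr_gt0.
have [[x0 Fx0]|F0] := pselect (exists x, F x); last first.
  apply: (@sub_null _ _ _ _ _ (\bigcup_(i : nat) set0)) => [x [Fx]|].
    by exfalso; apply: F0; exists x.
  apply: null_bigcup => // _ e e0; exists (fun=> set0), (fun=> 0); split => //.
  by move=> N; rewrite big1 ?ltW// => i _; rewrite expr0n eqn0Ngt n_gt0.
have lims := @null_limsup _ n n_gt0 _ d T S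
  (fun s => [set x | d s x <= K * (gap F s / 4)])
  (fun s => 2 * K * (gap F s / 4)) ((2 * K) ^+ n * M).
apply: (sub_null _ (lims _ _ _)) => {lims}.
- move=> x [Fx hx] s.
  (* Centres in the list have gap at least [2 * del], while the centre whose ball meets [B y] has
     gap at most [5 / 3 * d x y], which is below [2 * del]; it is therefore a new one. *)
  have [del del0 hdel] : exists2 del : R, 0 < del & forall i, i \in s -> S i -> del <= gap F i / 2.
    elim: s => [|i s [e e0 IH]]; first by exists 1.
    have [Si|Si] := pselect (S i); last first.
      exists e => // j; rewrite inE => /orP[/eqP->//|]; exact: IH.
    have [_ gi] := SD _ Si.
    exists (Num.min e (gap F i / 2)); first by rewrite lt_min e0 divr_gt0.
    move=> j; rewrite inE ge_min => /orP[/eqP->|js Sj]; first by rewrite lexx orbT.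
    by rewrite (IH j js Sj).
  have [y [Py dxy hy]] := hx _ del0.
  have y0 : 0 < d x y.
    rewrite lt_neqAle d_ge0 andbT eq_sym; apply/eqP => h0.
    by have := hy _ Fx; rewrite (dC y x) h0 mulr0 ltxx.
  have gy : k.+1%:R^-1 * d x y <= gap F y.
    by apply: (le_gap Fx) => z Fz; apply/ltW/hy.
  have gy0 : 0 < gap F y by apply: lt_le_trans gy; rewrite mulr_gt0// invr_gt0.
  have dgy : d x y <= k.+1%:R * gap F y.
    by move: gy; rewrite mulrC ler_pdivrMr// mulrC.
  have gyx : gap F y <= d x y by rewrite dC; exact: gap_le.
  have [i [Si [z [[_ iz] [_ yz]]]]] := meet y (conj Py gy0).
  have iy : d i y <= gap F i / 4 + gap F y / 4.
    by apply: le_trans (d_triangle z _ _) _; rewrite (dC z y) lerD.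
  have gi : gap F i <= d i y + gap F y := gap_triangle _ _ Fx.
  have gy' : gap F y <= d i y + gap F i by rewrite dC; exact: (gap_triangle _ _ Fx).
  exists i; split => //.
    apply/negP => /hdel /(_ Si) h; lra.
  rewrite /= /K; apply: le_trans (d_triangle y _ _) _; rewrite (dC y x).
  have : k.+1%:R * gap F y <= k.+1%:R * (2 * gap F i) :> R.
    rewrite ler_pM2l//; lra.
  nra.
- by move=> i /SD[_ gi]; rewrite !mulr_gt0.
- move=> s us sS; under eq_bigr do rewrite exprMn.
  rewrite -mulr_sumr; apply: ler_wpM2l; last by apply: Sum => //; exists x0.
  by rewrite exprn_ge0// mulr_ge0// ltW.
- move=> i x y _ /= ix iy; apply: le_trans (d_triangle i _ _) _.
  rewrite (dC x i); lra.
Qed.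

End porosity.

(** * Martingales on a tree *)

Section martingales_on_a_tree.
Context (R : realType) (C : finType).
Hypothesis C_gt0 : (0 < #|C|)%N.
Local Notation k := (#|C|%:R : R).
Implicit Types (w : seq C) (phi a : seq C -> R) (W : seq (seq C)).

Definition letter_mean (g : C -> R) : R := k^-1 * \sum_c g c.

Lemma letter_mean_cst x : letter_mean (fun=> x) = x.
Proof.
rewrite /letter_mean sumr_const -[x *+ _]mulr_natl mulrA mulVf ?mul1r//.
by rewrite pnatr_eq0 -lt0n.
Qed.

Lemma ler_letter_mean g h : (forall c, g c <= h c) ->
  letter_mean g <= letter_mean h.
Proof. by move=> gh; rewrite ler_wpM2l ?invr_ge0// ler_sum. Qed.

Lemma eq_letter_mean g h : g =1 h -> letter_mean g = letter_mean h.
Proof. by move=> gh; congr (_ * _); apply: eq_bigr => c _. Qed.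

Lemma letter_meanD g h :
  letter_mean (fun c => g c + h c) = letter_mean g + letter_mean h.
Proof. by rewrite /letter_mean big_split mulrDr. Qed.

Lemma letter_meanZ x g : letter_mean (fun c => x * g c) = x * letter_mean g.
Proof. by rewrite /letter_mean -mulr_sumr mulrCA. Qed.

(** The mean over all words of length [N], unfolded at the first letter so that inductions pass to
    the subtree below it. *)
Fixpoint level_mean N phi : R :=
  if N is N'.+1 then letter_mean (fun c => level_mean N' (fun w => phi (c :: w)))
  else phi [::].

Definition submartingale phi :=
  forall w, phi w <= letter_mean (fun c => phi (rcons w c)).

Definition martingale a := forall w, a w = letter_mean (fun c => a (rcons w c)).

Definition prefix_free W := {in W &, forall v w, prefix v w -> v = w}.

Lemma submartingale_cons phi c :
  submartingale phi -> submartingale (fun w => phi (c :: w)).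
Proof. by move=> sub w; exact: sub. Qed.

Lemma martingale_cons a c : martingale a -> martingale (fun w => a (c :: w)).
Proof. by move=> mar w; exact: mar. Qed.

Lemma level_mean_root phi N : submartingale phi -> phi [::] <= level_mean N phi.
Proof.
elim: N phi => [|N IH] phi sub //=; apply: le_trans (sub [::]) _.
apply: ler_letter_mean => c /=.
exact: (IH (fun w => phi (c :: w)) (submartingale_cons c sub)).
Qed.

Lemma level_mean_cst N x : level_mean N (fun=> x) = x.
Proof. by elim: N => //= N ->; rewrite letter_mean_cst. Qed.

Lemma ler_level_mean N phi psi : (forall w, phi w <= psi w) ->
  level_mean N phi <= level_mean N psi.
Proof.
elim: N phi psi => [|N IH] phi psi h //=.
by apply: ler_letter_mean => c; apply: IH => w.
Qed.

Lemma level_meanD N phi psi :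
  level_mean N (fun w => phi w + psi w) = level_mean N phi + level_mean N psi.
Proof.
elim: N phi psi => [|N IH] phi psi //=; rewrite -letter_meanD.
by apply: eq_letter_mean => c; rewrite IH.
Qed.

Lemma level_meanZ N x phi :
  level_mean N (fun w => x * phi w) = x * level_mean N phi.
Proof.
elim: N phi => [|N IH] phi //=; rewrite -letter_meanZ.
by apply: eq_letter_mean => c; rewrite IH.
Qed.

Lemma eq_level_mean N phi psi : phi =1 psi -> level_mean N phi = level_mean N psi.
Proof. by move=> /funext ->. Qed.

Lemma level_mean_martingale N a : martingale a -> level_mean N a = a [::].
Proof.
elim: N a => [|N IH] a mar //=; rewrite [RHS]mar.
by apply: eq_letter_mean => c; rewrite IH//; exact: martingale_cons.
Qed.

Lemma sum_words_by_head (F : seq C -> R) W : [::] \notin W ->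
  \sum_(w <- W) F w =
  \sum_c \sum_(w <- [seq behead w | w <- W & ohead w == Some c]) F (c :: w).
Proof.
elim: W => [|w W IH]; first by rewrite big_nil big1// => c _; rewrite big_nil.
rewrite inE negb_or => /andP[]; case: w => // b w _ /IH {}IH.
rewrite big_cons IH /=.
transitivity (\sum_c ((if b == c then F (b :: w) else 0) +
   \sum_(v <- [seq behead v | v <- W & ohead v == Some c]) F (c :: v))).
  rewrite big_split /=; congr (_ + _).
  by rewrite -big_mkcond /= (big_pred1 b)// => c; rewrite eq_sym.
apply: eq_bigr => c _; have [->|bc] := eqVneq b c.
  by rewrite eqxx /= big_cons.
by case: eqP => [[bc']|_]; [rewrite bc' eqxx in bc|rewrite add0r].
Qed.

(** Optional stopping. A word is a cell of measure [k^-1 ^+ size w], and prefix-free words are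
    disjoint cells. The value at a cell is at most the mean of [phi] over its descendants at level
    [N], and the rest of that level contributes a nonnegative amount. *)
Lemma prefix_free_sum_le phi W N :
  (forall w, 0 <= phi w) -> submartingale phi -> uniq W -> prefix_free W ->
  (forall w, w \in W -> (size w <= N)%N) ->
  \sum_(w <- W) k^-1 ^+ size w * phi w <= level_mean N phi.
Proof.
elim: N phi W => [|N IH] phi W phi0 sub uW pW sW; last first.
- have [nilW|nilW] := boolP ([::] \in W).
    suff -> : W = [:: [::]].
      by rewrite big_seq1 expr0 mul1r; exact: (level_mean_root N.+1).
    have all0 w : w \in W -> w = [::].
      by move=> wW; apply/esym/pW => //; rewrite prefix0s.
    case: W nilW uW {pW sW} all0 => // v W _ /andP[vW _] all0; have v0 := all0 _ (mem_head _ _).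
    case: W vW all0 => [|u W]; first by rewrite v0.
    move=> vW all0; have u0 : u = [::] by apply: all0; rewrite !inE eqxx orbT.
    by rewrite v0 u0 inE eqxx in vW.
  rewrite sum_words_by_head //= /letter_mean mulr_sumr; apply: ler_sum => c _.
  under eq_bigr do rewrite exprS -mulrA.
  rewrite -mulr_sumr ler_wpM2l ?invr_ge0//.
  have inj w : w \in [seq behead w | w <- W & ohead w == Some c] -> c :: w \in W.
    move=> /mapP[[|b v]]; rewrite mem_filter //= => /andP[/eqP[->] vW] -> //.
  apply: (IH (fun w => phi (c :: w))) => //.
  + rewrite map_inj_in_uniq ?filter_uniq// => v w.
    rewrite !mem_filter; case: v => [|x v]; case: w => [|y w] //=.
    by move=> /andP[/eqP[->] _] /andP[/eqP[->] _] ->.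
  + move=> v w /inj vW /inj wW vw.
    by have [] : c :: v = c :: w by apply: pW => //=; rewrite eqxx.
  + by move=> w /inj /sW.
- have all0 w : w \in W -> w = [::] by move=> /sW; case: w.
  case: W uW {pW sW} all0 => [|v W] /=; first by rewrite big_nil.
  move=> /andP[vW _] all0; have v0 := all0 _ (mem_head _ _).
  case: W vW all0 => [|u W] vW all0.
    by rewrite big_seq1 v0 expr0 mul1r.
  have u0 : u = [::] by apply: all0; rewrite !inE eqxx orbT.
  by rewrite v0 u0 inE eqxx in vW.
Qed.

(** This plays the part of the additivity of Lebesgue measure: disjoint dyadic cubes of the unit
    cube have total volume at most 1. *)
Lemma kraft W : uniq W -> prefix_free W -> \sum_(w <- W) k^-1 ^+ size w <= 1.
Proof.
move=> uW pW.
pose N := \max_(w <- W) size w.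
have sub1 : submartingale (fun=> 1) by move=> w; rewrite letter_mean_cst.
have sN w : w \in W -> (size w <= N)%N.
  by move=> wW; exact: (@leq_bigmax_seq _ W xpredT size w wW).
have := prefix_free_sum_le (fun=> ler01) sub1 uW pW sN.
by rewrite level_mean_cst -mulr_suml mulr1.
Qed.

(** The squared increment since level [M], set to zero on shorter words so as to be a submartingale
    on the whole tree. *)
Let variation a M w := if (size w < M)%N then 0 else (a w - a (take M w)) ^+ 2.

(** Pythagoras: the increment after level [M] is orthogonal to the value at level [M]. Peeling off
    [M] letters reduces this to expanding a square around the root value, which is the mean of
    [a]. *)
Lemma level_mean_variation a M N : martingale a ->
  level_mean (M + N) (variation a M) =
  level_mean (M + N) (fun w => a w ^+ 2) - level_mean M (fun w => a w ^+ 2).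
Proof.
elim: M a => [|M IH] a mar.
  rewrite add0n /=.
  transitivity (level_mean N (fun w => a w ^+ 2 + ((- 2 * a [::]) * a w + a [::] ^+ 2))).
    by apply: eq_level_mean => w; rewrite /variation ltn0 take0 /=; ring.
  rewrite level_meanD level_meanD level_meanZ level_mean_cst (level_mean_martingale N mar).
  ring.
rewrite addSn /= -[X in _ - X]mul1r -mulNr -letter_meanZ -letter_meanD.
apply: eq_letter_mean => c.
rewrite mulN1r -(IH (fun w => a (c :: w)))//; exact: martingale_cons.
Qed.

(** From level [M] on, the subtracted value [a (take M w)] is frozen, and the mean of a square is at
    least the square of the mean since variances are nonnegative. *)
Lemma submartingale_variation a M : martingale a -> submartingale (variation a M).
Proof.
move=> mar w; rewrite /variation; have [wM|wM] := ltnP (size w) M.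
  rewrite /letter_mean mulr_ge0 ?invr_ge0 ?sumr_ge0// => c _.
  by case: ifP => // _; rewrite sqr_ge0.
set x := a (take M w).
rewrite (_ : letter_mean _ = letter_mean (fun c => a (rcons w c) ^+ 2 + (- 2 * x * a (rcons w c) + x ^+ 2))); last first.
  apply: eq_letter_mean => c; rewrite size_rcons ltnNge (leqW wM) /=.
  by rewrite -cats1 takel_cat// -/x cats1; ring.
rewrite !letter_meanD letter_meanZ -mar letter_mean_cst.
suff : a w ^+ 2 <= letter_mean (fun c => a (rcons w c) ^+ 2) by move=> h; nra.
have : 0 <= letter_mean (fun c => (a (rcons w c) - a w) ^+ 2).
  by rewrite /letter_mean mulr_ge0 ?invr_ge0 ?sumr_ge0// => c _; rewrite sqr_ge0.
rewrite (_ : letter_mean _ = letter_mean (fun c => a (rcons w c) ^+ 2 + (- 2 * a w * a (rcons w c) + a w ^+ 2))); last first.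
  by apply: eq_letter_mean => c; ring.
rewrite !letter_meanD letter_meanZ -mar letter_mean_cst => h; nra.
Qed.

(* Chebyshev for the orthogonal increments after level [M], where [M] captures
   almost all of the bounded energy [level_mean N (a ^+ 2)]. *)
Lemma martingale_deviation a (B e eta : R) : martingale a ->
  (forall w, `|a w| <= B) -> 0 < e -> 0 < eta ->
  exists M, forall W, uniq W -> prefix_free W ->
    (forall w, w \in W -> (M <= size w)%N /\ e < `|a w - a (take M w)|) ->
    \sum_(w <- W) k^-1 ^+ size w <= eta.
Proof.
move=> mar aB e0 eta0.
pose E N := level_mean N (fun w => a w ^+ 2).
have EB N : E N <= B ^+ 2.
  rewrite -(level_mean_cst N (B ^+ 2)); apply: ler_level_mean => w.
  by rewrite -real_normK ?num_real// lerXn2r ?nnegrE// (le_trans _ (aB w)).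
pose X := [set x | exists N, x = E N].
have hX : has_sup X.
  split; first by exists (E 0%N), 0%N.
  by exists (B ^+ 2) => _ [N ->].
have ee : 0 < e ^+ 2 * eta by rewrite mulr_gt0// exprn_gt0.
have [_ [M ->] hM] := sup_adherent ee hX.
exists M => W uW pW hW.
pose N := \max_(w <- W) size w.
have sN w : w \in W -> (size w <= M + N)%N.
  move=> wW; apply: leq_trans (leq_addl _ _).
  exact: (@leq_bigmax_seq _ W xpredT size w wW).
have h0 w : 0 <= variation a M w by rewrite /variation; case: ifP => // _; rewrite sqr_ge0.
have := prefix_free_sum_le h0 (submartingale_variation M mar) uW pW sN.
rewrite level_mean_variation// => hs.
have : E (M + N)%N <= sup X by apply: sup_upper_bound => //; exists (M + N)%N.
move: hs; rewrite -/(E _) -/(E _) => hs hE.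
rewrite -(ler_pM2l (_ : 0 < e ^+ 2)) ?exprn_gt0//.
apply: le_trans (_ : \sum_(w <- W) k^-1 ^+ size w * variation a M w <= _); last lra.
rewrite mulr_sumr big_seq [leRHS]big_seq; apply: ler_sum => w /hW[Mw ew].
rewrite mulrC ler_wpM2l ?exprn_ge0 ?invr_ge0// /variation ltnNge Mw /=.
rewrite -[leRHS]real_normK ?num_real// lerXn2r ?nnegrE ?ltW//.
exact: lt_trans ew.
Qed.

End martingales_on_a_tree.

(** * Dyadic cubes *)

Lemma dyadic_scale (R : realType) (t : R) : 0 < t -> t <= 1 ->
  exists m : nat, 2^-1 ^+ m <= t /\ t <= 2 * 2^-1 ^+ m.
Proof.
move=> t0 t1.
have ex : exists m, 2^-1 ^+ m <= t.
  have [m hm] := ltr_add_invr t0; rewrite add0r in hm.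
  exists m; apply/ltW; apply: le_lt_trans hm.
  rewrite exprVn lef_pV2 ?posrE ?exprn_gt0// -natrX ler_nat.
  exact: ltn_expl.
case: (ex_minnP ex) => -[|m] hm hmin.
  by exists 0%N; move: hm; rewrite expr0 mulr1; split => //; lra.
exists m.+1; split => //.
rewrite exprS mulrA mulfV// mul1r leNgt; apply/negP => h.
by have := hmin _ (ltW h); rewrite ltnn.
Qed.

Section dyadic_cubes.
Context (R : realType) (n : nat).
Local Notation V := 'rV[R]_n.
Local Notation letter := {ffun 'I_n -> bool}.
Implicit Types (x y : V) (w : seq letter).

Definition sup_dist x y : R := `|x - y|.

Lemma norm_row_le x (e : R) : 0 <= e -> (forall i, `|x ord0 i| <= e) -> `|x| <= e.
Proof.
move=> e0 h; rewrite [`|x|]mx_normrE; apply: bigmax_le => // -[i j] _ /=.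
by rewrite (ord1 i).
Qed.

Lemma coord_norm_le x i : `|x ord0 i| <= `|x|.
Proof.
rewrite [leRHS]mx_normrE.
exact: (@le_bigmax _ _ _ 0 (fun ij : 'I_1 * 'I_n => `|x ij.1 ij.2|) (ord0, i)).
Qed.

(** Half-open, so that every point lies in exactly one dyadic cube of each level. *)
Definition unit_box : set V := [set x | forall i, 0 <= x ord0 i < 1].

Definition vec_of (c : letter) : V := \row_i (c i)%:R.

Definition digit x : letter := [ffun i => 2^-1 <= x ord0 i].

(** Binary expansion in all coordinates at once: a word codes a dyadic cube of side [2^-1 ^+ m], and
    its prefixes code the larger cubes that contain it. *)
Fixpoint address x m : seq letter :=
  if m is m'.+1 then digit x :: address (2 *: x - vec_of (digit x)) m'
  else [::].

(** The vertex of the cube coded by [w] at which all coordinates are smallest. *)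
Definition corner w : V := foldr (fun c p => 2^-1 *: (vec_of c + p)) 0 w.

Lemma size_address x m : size (address x m) = m.
Proof. by elim: m x => //= m IH x; rewrite IH. Qed.

Lemma take_address x m M : (M <= m)%N -> take M (address x m) = address x M.
Proof. by elim: m M x => [|m IH] [|M] x //= Mm; rewrite IH. Qed.

Lemma prefix_address v x m : prefix v (address x m) -> v = address x (size v).
Proof.
move=> /[dup] pv; rewrite prefixE => /eqP <-.
by rewrite take_address ?size_address// -(size_address x m); exact: size_prefix.
Qed.

Lemma unit_box_shift x : unit_box x -> unit_box (2 *: x - vec_of (digit x)).
Proof.
move=> xb i; have /andP[x0 x1] := xb i; rewrite !mxE ffunE.
by case: (leP 2^-1 (x ord0 i)) => h /=; apply/andP; split; lra.
Qed.

Lemma corner_address x m i : unit_box x ->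
  0 <= 2 ^+ m * (x ord0 i - corner (address x m) ord0 i) < 1.
Proof.
elim: m x => [|m IH] x xb.
  by rewrite expr0 mul1r mxE subr0; exact: xb.
have := IH _ (unit_box_shift xb).
set y := 2 *: x - _ => h.
rewrite (_ : 2 ^+ m.+1 * _ = 2 ^+ m * (y ord0 i - corner (address y m) ord0 i)); first exact: h.
by rewrite [corner _]/= -/y exprS [in RHS]/y !mxE; field.
Qed.

Lemma corner_rcons w c :
  corner (rcons w c) = corner w + 2^-1 ^+ (size w).+1 *: vec_of c.
Proof.
elim: w => [|b w IH] /=; first by rewrite addr0 add0r expr1.
by rewrite IH addrA scalerDr scalerA -exprS.
Qed.

Lemma corner_lattice w i : exists k : nat, 2 ^+ size w * corner w ord0 i = k%:R.
Proof.
elim: w => [|c w [k hk]] /=; first by exists 0%N; rewrite mxE mulr0.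
exists (c i * 2 ^ size w + k)%N.
rewrite !mxE exprSr -mulrA mulVKf// mulrDr hk natrD natrM natrX mulrC.
by [].
Qed.

(** Both [2 ^+ m * z] and the rescaled corner are the integer part of [2 ^+ m * y]. This recognises
    a lattice point as the corner of the cube of any point lying just above it. *)
Lemma corner_address_eq y m (z : V) : unit_box y ->
  (forall i, exists k : int, 2 ^+ m * z ord0 i = k%:~R) ->
  (forall i, 0 <= 2 ^+ m * (y ord0 i - z ord0 i) < 1) ->
  corner (address y m) = z.
Proof.
move=> yb zk hz; apply/rowP => i.
have [k hk] := zk i.
have [l hl] := corner_lattice (address y m) i; rewrite size_address in hl.
have /andP[a0 a1] := corner_address m i yb.
have /andP[b0 b1] := hz i.
have : (k - l%:Z)%:~R < 1 :> R /\ -1 < (k - l%:Z)%:~R :> R.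
  rewrite rmorphB /= -pmulrn -hk -hl.
  by move: a0 a1 b0 b1; rewrite !mulrBr; split; lra.
rewrite -[1]/(1%:~R) -mulrNz !ltr_int => -[k1 k2].
have kl : k = l%:Z by lia.
have h2 : (2 : R) ^+ m != 0 by rewrite expf_neq0.
by apply: (mulfI h2); rewrite hk hl kl.
Qed.

Lemma address_eq_dist x y m : unit_box x -> unit_box y ->
  address x m = address y m -> `|x - y| <= 2^-1 ^+ m.
Proof.
move=> xb yb xy; apply: norm_row_le; first by rewrite exprn_ge0.
move=> i; have /andP[a0 a1] := corner_address m i xb.
have /andP[b0 b1] := corner_address m i yb.
rewrite exprVn -[leRHS]mulr1 ler_pdivlMl ?exprn_gt0//.
rewrite -[X in X * _](ger0_norm (_ : 0 <= 2 ^+ m)) ?exprn_ge0// -normrM !mxE.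
by move: a0 a1 b0 b1; rewrite xy !mulrBr ler_norml => *; lra.
Qed.

Lemma card_letter : #|[the finType of letter]| = (2 ^ n)%N.
Proof. by rewrite card_ffun card_bool card_ord. Qed.

Lemma letter_weight m :
  #|[the finType of letter]|%:R^-1 ^+ m = (2^-1 ^+ m) ^+ n :> R.
Proof. by rewrite card_letter natrX -exprVn -!exprM mulnC. Qed.

Lemma card_letter_gt0 : (0 < #|[the finType of letter]|)%N.
Proof. by rewrite card_letter expn_gt0. Qed.

Hypothesis n_gt0 : (0 < n)%N.

(** Inside each ball take the dyadic cube of its centre whose side is between half the radius and
    the radius. If one of these cubes contained another, the smaller one's centre would lie in both
    balls, so the words are prefix-free and [kraft] applies; the factor 2 in the sides becomes
    [2 ^+ n]. *)
Lemma unit_box_packing : bounded_packing n sup_dist unit_box (2 ^+ n).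
Proof.
move=> s r us rs sep.
have /choice[m hm] x : exists m : nat, x \in s ->
    2^-1 ^+ m <= r x /\ r x <= 2 * 2^-1 ^+ m.
  have [xs|xs] := boolP (x \in s); last by exists 0%N.
  have [_ rx0 [p [q [pb qb rpq]]]] := rs _ xs.
  have rx1 : r x <= 1.
    apply: le_trans rpq _; apply: norm_row_le => // i; rewrite !mxE.
    by have := pb i; have := qb i; rewrite ler_norml; lra.
  by have [m hm] := dyadic_scale rx0 rx1; exists m.
have key x y : x \in s -> y \in s -> prefix (address x (m x)) (address y (m y)) -> x = y.
  move=> xs ys pxy; apply: contrapT => /eqP xy.
  have [xb rx _] := rs _ xs; have [yb ry _] := rs _ ys.
  apply: (sep x y y) => //; last by rewrite /sup_dist subrr normr0 ltW.
  have [h _] := hm _ xs; apply: le_trans h.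
  apply: address_eq_dist => //.
  by rewrite [LHS](prefix_address pxy) size_address.
pose W := [seq address x (m x) | x <- s].
have uW : uniq W.
  rewrite map_inj_in_uniq// => x y xs ys xy; apply: key => //.
  by rewrite xy prefix_refl.
have pW : prefix_free W.
  by move=> _ _ /mapP[x xs ->] /mapP[y ys ->] /(key _ _ xs ys) ->.
have := kraft R card_letter_gt0 uW pW.
rewrite big_map => hW.
apply: le_trans (_ : \sum_(x <- s) 2 ^+ n * #|[the finType of letter]|%:R^-1 ^+ size (address x (m x)) <= _).
  rewrite big_seq [leRHS]big_seq; apply: ler_sum => x xs.
  have [_ rx0 _] := rs _ xs; have [_ h] := hm _ xs.
  rewrite letter_weight size_address -exprMn lerXn2r ?nnegrE//; first exact: ltW.
by rewrite -mulr_sumr -[leRHS]mulr1 ler_wpM2l ?exprn_ge0.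
Qed.

Lemma null_not_dense_in_unit_box (F : set V) : F `<=` unit_box ->
  null n sup_dist [set x | F x /\ ~ dense_at sup_dist unit_box F x].
Proof.
apply: (@null_not_dense_at _ n n_gt0 V sup_dist _ _ _ _ _ _ (2 ^+ n)).
- by move=> x; rewrite /sup_dist subrr normr0.
- by move=> x y; exact: normr_ge0.
- by move=> x y; exact: distrC.
- by move=> y x z; exact: ler_distD.
- exact: unit_box_packing.
Qed.

(** A stopping time: the first cube at which [Q] holds on the way down from the unit cube. *)
Definition minimal_word (Q : seq letter -> Prop) w :=
  Q w /\ forall v, prefix v w -> Q v -> v = w.

Lemma minimal_word_address (Q : seq letter -> Prop) x m : Q (address x m) ->
  exists k, minimal_word Q (address x k).
Proof.
move=> Qm; have ex : exists k, `[< Q (address x k) >] by exists m; apply/asboolP.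
case: (ex_minnP ex) => k /asboolP Qk kmin; exists k; split => // v pv Qv.
have vE := prefix_address pv; rewrite vE in Qv *; congr address.
apply/eqP; rewrite eqn_leq kmin ?andbT; last by apply/asboolP.
by rewrite -[leqRHS](size_address x); exact: size_prefix.
Qed.

Lemma prefix_free_minimal (Q : seq letter -> Prop) (W : seq (seq letter)) :
  (forall w, w \in W -> minimal_word Q w) -> prefix_free W.
Proof.
by move=> WQ v w /WQ[Qv _] /WQ[_ h] /h; apply.
Qed.

(** The cubes at which [Q] first holds are disjoint and cover [A]; the hypothesis bounds their total
    volume. *)
Lemma null_of_stopping (A : set V) : A `<=` unit_box ->
  (forall e : R, 0 < e -> exists Q : seq letter -> Prop,
     (forall x, A x -> exists m, Q (address x m)) /\
     (forall W, uniq W -> prefix_free W -> (forall w, w \in W -> Q w) ->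
        \sum_(w <- W) #|[the finType of letter]|%:R^-1 ^+ size w <= e)) ->
  null n sup_dist A.
Proof.
move=> Ab stop e e0; have [Q [AQ QW]] := stop e e0.
apply: (@cover_of_countable _ n n_gt0 V sup_dist _ (minimal_word Q)
  (fun w => [set x | unit_box x /\ address x (size w) = w])
  (fun w => 2^-1 ^+ size w)).
- exact: countableP.
- by move=> w _; rewrite exprn_ge0.
- by move=> w x y _ [xb xw] [yb yw]; apply: address_eq_dist; rewrite ?xw ?yw.
- move=> x Ax; have [m /minimal_word_address[k mk]] := AQ x Ax.
  by exists (address x k) => //=; split; [exact: Ab|rewrite size_address].
- move=> W uW WQ; under eq_bigr do rewrite -letter_weight.
  by apply: QW => //; [exact: prefix_free_minimal WQ|move=> w /WQ[]].
Qed.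

Lemma null_martingale_oscillation (a : seq letter -> R) (B e : R) :
  martingale a -> (forall w, `|a w| <= B) -> 0 < e ->
  null n sup_dist [set x | unit_box x /\
    forall M, exists2 m, (M <= m)%N & e < `|a (address x m) - a (address x M)|].
Proof.
move=> mar aB e0; apply: null_of_stopping => [x []//|eta eta0].
have [M hM] := martingale_deviation card_letter_gt0 mar aB e0 eta0.
exists (fun w => (M <= size w)%N /\ e < `|a w - a (take M w)|); split => //.
move=> x [xb /(_ M)[m Mm em]]; exists m.
by rewrite size_address take_address.
Qed.

End dyadic_cubes.

(** * Mean slopes *)

Section mean_slopes.
Context (R : realType) (n : nat).
Local Notation V := 'rV[R]_n.
Local Notation letter := {ffun 'I_n -> bool}.
Local Notation e_ i := (delta_mx ord0 i : V).
Implicit Types (f g : V -> R) (x y : V) (s : seq 'I_n).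

Lemma norm_delta_le i (t : R) : `|t *: e_ i| <= `|t|.
Proof.
apply: norm_row_le => // k; rewrite !mxE eqxx /=.
by case: (k == i); rewrite ?mulr1// mulr0 normr0.
Qed.

(** A Riemann sum for the mean of [g] over the segment of length [K%:R * dl] issuing from [x] in
    direction [i]. Folding it over a list of directions gives the mean over a face. *)
Definition ray_mean (K : nat) (dl : R) i g x :=
  K%:R^-1 * \sum_(t < K) g (x + (t%:R * dl) *: e_ i).

Definition pair_mean (h : R) i g x := 2^-1 * (g x + g (x + h *: e_ i)).

Lemma ray_mean_double K dl i g : (0 < K)%N ->
  ray_mean (K + K) dl i g = pair_mean (K%:R * dl) i (ray_mean K dl i g).
Proof.
move=> K0; apply/funext => x.
rewrite /pair_mean /ray_mean -mulrDr mulrA big_split_ord /=; congr (_ * (_ + _)).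
  by rewrite -invfM -natrM mul2n addnn.
by apply: eq_bigr => t _; congr g; rewrite natrD mulrDl scalerDl addrA.
Qed.

Lemma ray_mean_pair_mean K dl i h k g :
  ray_mean K dl i (pair_mean h k g) = pair_mean h k (ray_mean K dl i g).
Proof.
apply/funext => x; rewrite /pair_mean /ray_mean -mulr_sumr big_split /=.
rewrite mulrCA; congr (_ * _); rewrite mulrDr; congr (_ + _ * _).
by apply: eq_bigr => t _; congr g; rewrite addrAC.
Qed.

Lemma ray_mean_foldr_double K dl s f : (0 < K)%N ->
  foldr (ray_mean (K + K) dl) f s =
  foldr (pair_mean (K%:R * dl)) (foldr (ray_mean K dl) f s) s.
Proof.
move=> K0; elim: s f => [|i s IH] f //=; rewrite IH ray_mean_double//; congr pair_mean.
move: (foldr _ f s) => g; elim: s {IH} => //= k s <-.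
by rewrite ray_mean_pair_mean.
Qed.

Lemma ray_mean_lipschitz K dl i g L : (0 < K)%N ->
  (forall x y, `|g x - g y| <= L * `|x - y|) ->
  forall x y, `|ray_mean K dl i g x - ray_mean K dl i g y| <= L * `|x - y|.
Proof.
move=> K0 gL x y; rewrite /ray_mean -mulrBr -sumrB normrM ger0_norm ?invr_ge0//.
rewrite ler_pdivrMl ?ltr0n//; apply: le_trans (ler_norm_sum _ _ _) _.
apply: le_trans (_ : \sum_(t < K) L * `|x - y| <= _).
  apply: ler_sum => t _; apply: le_trans (gL _ _) _.
  by rewrite opprD addrACA subrr addr0.
by rewrite sumr_const card_ord -[leLHS]mulr_natl.
Qed.

Lemma ray_mean_close K dl i g L : (0 < K)%N -> 0 <= dl -> 0 <= L ->
  (forall x y, `|g x - g y| <= L * `|x - y|) ->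
  forall x, `|ray_mean K dl i g x - g x| <= L * (K%:R * dl).
Proof.
move=> K0 dl0 L0 gL x.
have -> : g x = K%:R^-1 * \sum_(t < K) g x.
  rewrite sumr_const card_ord -[g x *+ K]mulr_natl mulrA mulVf ?mul1r//.
  by rewrite pnatr_eq0 -lt0n.
rewrite /ray_mean -mulrBr -sumrB normrM ger0_norm ?invr_ge0//.
rewrite ler_pdivrMl ?ltr0n//; apply: le_trans (ler_norm_sum _ _ _) _.
apply: le_trans (_ : \sum_(t < K) L * (K%:R * dl) <= _).
  apply: ler_sum => t _; apply: le_trans (gL _ _) _.
  rewrite addrAC subrr add0r ler_wpM2l//; apply: le_trans (norm_delta_le _ _) _.
  by rewrite ger0_norm ?mulr_ge0// ler_wpM2r// ler_nat ltnW.
by rewrite sumr_const card_ord -[leLHS]mulr_natl.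
Qed.

Lemma ray_mean_foldr_close K dl s f L : (0 < K)%N -> 0 <= dl -> 0 <= L ->
  (forall x y, `|f x - f y| <= L * `|x - y|) ->
  (forall x y, `|foldr (ray_mean K dl) f s x - foldr (ray_mean K dl) f s y|
     <= L * `|x - y|) /\
  (forall x, `|foldr (ray_mean K dl) f s x - f x| <=
     (size s)%:R * (L * (K%:R * dl))).
Proof.
move=> K0 dl0 L0 fL; elim: s => [|i s [IH1 IH2]] /=.
  by split=> // x; rewrite subrr normr0 mul0r.
split; first exact: ray_mean_lipschitz.
move=> x; rewrite -[_ - f x](subrKA (foldr (ray_mean K dl) f s x)).
apply: le_trans (ler_normD _ _) _.
rewrite -natr1 mulrDl mul1r [leRHS]addrC lerD//.
exact: ray_mean_close.
Qed.

(** Each direction in [s] offers the choice of moving by [h] or staying, and a letter supported in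
    [s] records these choices: iterated halving averages over dyadic subcubes. *)
Lemma pair_mean_foldr h s g x : uniq s ->
  foldr (pair_mean h) g s x =
  2^-1 ^+ size s * \sum_(c : letter | [forall i, c i ==> (i \in s)])
    g (x + h *: vec_of R c).
Proof.
elim: s x => [|i s IH] x /=.
  move=> _; rewrite expr0 mul1r (big_pred1 [ffun=> false]); last first.
    move=> c; apply/forallP/eqP => [h0|-> i]; last by rewrite ffunE.
    by apply/ffunP => i; have := h0 i; rewrite ffunE in_nil implybF => /negbTE.
  by congr g; apply/rowP => i; rewrite !mxE ffunE mulr0 addr0.
case/andP => ni us; rewrite /pair_mean !IH// -mulrDr exprS -mulrA.
congr (_ * (_ * _)).
rewrite [RHS](bigID (fun c : letter => c i)) /= addrC; congr (_ + _).
  apply: eq_bigl => c; apply/forallP/andP => [h0|[/forallP h0 ci] k].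
    split; last by have := h0 i; rewrite (negbTE ni) implybF.
    by apply/forallP => k; have := h0 k; rewrite inE; case: (c k) => //= ->; rewrite orbT.
  have := h0 k; rewrite inE; case E : (c k) => //=.
  by have [ki|] //= := eqVneq k i; rewrite ki (negbTE ci) in E.
(* Clearing bit [i] matches the letters that contain [i] with those supported in [s]. *)
rewrite [RHS](reindex_onto (fun c : letter => [ffun k => (k == i) || c k])
  (fun c : letter => [ffun k => (k != i) && c k])) /=; last first.
  move=> c /andP[_ ci]; apply/ffunP => k; rewrite !ffunE.
  by have [->|] := eqVneq k i; rewrite ?ci.
apply: eq_big => c.
  apply/forallP/andP.
    move=> h0; split; last first.
      apply/eqP/ffunP => k; rewrite !ffunE; have [->|] //= := eqVneq k i.
      by apply/esym/negbTE; have := h0 i; rewrite (negbTE ni) implybF.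
    rewrite ffunE eqxx andbT; apply/forallP => k; rewrite ffunE inE.
    by have := h0 k; case: (k == i).
  move=> [/andP[/forallP h0 _] /eqP h1] k.
  have := h0 k; rewrite ffunE inE.
  have [->|ki] //= := eqVneq k i.
  by rewrite -h1 !ffunE eqxx.
move=> /forallP h0; congr g; rewrite -addrA -scalerDr; congr (_ + _ *: _).
apply/rowP => k; rewrite !mxE !ffunE eqxx /=.
have [->|] := eqVneq k i => /=; last by rewrite add0r.
by have := h0 i; rewrite (negbTE ni) implybF => /negbTE ->; rewrite addr0.
Qed.

Lemma cvg_pair_mean_foldr (F : set_system nat) {FF : ProperFilter F} h s
    (gN : nat -> V -> R) g :
  (forall x, gN N x @[N --> F] --> g x) ->
  forall x, foldr (pair_mean h) (gN N) s x @[N --> F] --> foldr (pair_mean h) g s x.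
Proof.
move=> gNg; elim: s => [|i s IH] x //=.
by apply: cvgM; [exact: cvg_cst|exact: cvgD].
Qed.

(** [phi m x] is the mean of [f] over the face of side [2^-1 ^+ m] at [x] spanned by [s], as a limit
    of Riemann sums of mesh [2^-1 ^+ N]. At a common mesh the sums over a face and over its halves
    are related exactly, and the relation passes to the limit. *)
Lemma exists_face_means f L s : 0 <= L ->
  (forall x y, `|f x - f y| <= L * `|x - y|) ->
  exists phi : nat -> V -> R,
  [/\ forall m x y, `|phi m x - phi m y| <= L * `|x - y|,
      forall m x, `|phi m x - f x| <= (size s)%:R * (L * 2^-1 ^+ m) &
      forall m, phi m = foldr (pair_mean (2^-1 ^+ m.+1)) (phi m.+1) s].
Proof.
move=> L0 fL.
have [U [UU oU]] := ultraFilterLemma (F := \oo) _.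
(* The subtraction [N - m] is truncated; only [N] at least [m] matters, and the ultrafilter refines
   [\oo]. *)
pose phiN m N := foldr (ray_mean (2 ^ (N - m)) (2^-1 ^+ N)) f s.
have step m N : (m <= N)%N -> (2 ^ (N - m))%:R * 2^-1 ^+ N = 2^-1 ^+ m :> R.
  move=> mN; rewrite -{2}(subnK mN) exprD mulrA natrX -exprMn mulfV//.
  by rewrite expr1n mul1r.
have dl0 N : 0 <= 2^-1 ^+ N :> R by rewrite exprn_ge0.
have K0 m N : (0 < 2 ^ (N - m))%N by rewrite expn_gt0.
have near_le m (P : nat -> Prop) : (forall N, (m <= N)%N -> P N) -> \forall N \near U, P N.
  by move=> h; apply: oU; exists m.
have close m N x : (m <= N)%N -> `|phiN m N x - f x| <= (size s)%:R * (L * 2^-1 ^+ m).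
  move=> mN; rewrite -(step _ _ mN).
  by have [_ h] := ray_mean_foldr_close s (K0 m N) (dl0 N) L0 fL; exact: h.
have cvgphi m x : exists l, phiN m N x @[N --> U] --> (l : R).
  pose b := (size s)%:R * (L * 2^-1 ^+ m).
  have cpt := @segment_compact R (f x - b) (f x + b).
  have [|l [_ hl]] := cpt (phiN m N x @[N --> U]) _.
    apply: (near_le m) => N mN /=; rewrite in_itv /=.
    have := close m N x mN; rewrite ler_norml => /andP[h1 h2].
    by apply/andP; rewrite /b; split; lra.
  (* Along an ultrafilter a cluster point is a limit, since a set or its complement belongs to
     it. *)
  exists l => B Bl; have [//|UB] := in_ultra_setVsetC ((phiN m)^~ x @^-1` B) UU.
  have [|y [/= yB By]] := hl (~` B) B _ Bl; first exact: UB.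
  by [].
have /choice[phi hphi] m : exists p : V -> R, forall x, phiN m N x @[N --> U] --> p x.
  by have /choice[p hp] := cvgphi m; exists p.
exists phi; split.
- move=> m x y.
  have h : `|phiN m N x - phiN m N y| @[N --> U] --> `|phi m x - phi m y|.
    by apply: cvg_norm; exact: cvgB.
  rewrite -(cvg_lim (@Rhausdorff R) h); apply: limr_le.
    by apply/cvg_ex; exists (`|phi m x - phi m y|).
  apply: (near_le 0%N) => N _.
  by have [+ _] := ray_mean_foldr_close s (K0 m N) (dl0 N) L0 fL; apply.
- move=> m x.
  have h : `|phiN m N x - f x| @[N --> U] --> `|phi m x - f x|.
    by apply: cvg_norm; apply: cvgB => //; exact: cvg_cst.
  rewrite -(cvg_lim (@Rhausdorff R) h); apply: limr_le.
    by apply/cvg_ex; exists (`|phi m x - f x|).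
  by apply: (near_le m) => N mN; exact: close.
- move=> m; apply/funext => x.
  have h : foldr (pair_mean (2^-1 ^+ m.+1)) (phiN m.+1 N) s x @[N --> U] -->
           foldr (pair_mean (2^-1 ^+ m.+1)) (phi m.+1) s x.
    exact: cvg_pair_mean_foldr (hphi m.+1) x.
  apply: (cvg_unique _ (hphi m x)) => //.
  apply: cvg_trans h; apply: near_eq_cvg.
  apply: (near_le m.+1) => N mN; rewrite /phiN.
  have -> : (2 ^ (N - m) = 2 ^ (N - m.+1) + 2 ^ (N - m.+1))%N.
    by rewrite addnn -mul2n -expnS -subSn.
  by rewrite ray_mean_foldr_double// step.
Qed.

(* [a m x] is the mean over the dyadic cube with corner [x] and side [2^-m] of
   the partial derivative of [f] in direction [j], obtained from the means of
   [f] over the two faces orthogonal to [j]. *)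
Lemma exists_mean_slopes f L j : 0 <= L ->
  (forall x y, `|f x - f y| <= L * `|x - y|) ->
  exists a : nat -> V -> R,
  [/\ forall m x, `|a m x| <= L,
      forall m x, a m x = letter_mean
        (fun c : letter => a m.+1 (x + 2^-1 ^+ m.+1 *: vec_of R c)) &
      forall m x K, `|2^-1 ^+ m * (\sum_(t < K) a m (x + (t%:R * 2^-1 ^+ m) *: e_ j))
        - (f (x + (K%:R * 2^-1 ^+ m) *: e_ j) - f x)|
        <= 2 * n%:R * L * 2^-1 ^+ m].
Proof.
move=> L0 fL; pose s := rem j (enum 'I_n).
have us : uniq s by rewrite rem_uniq// enum_uniq.
have js : j \notin s by rewrite mem_rem_uniqF// enum_uniq.
have ss : size s = n.-1 by rewrite size_rem ?mem_enum// size_enum_ord.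
have sn : (size s <= n)%N by rewrite ss leq_pred.
have [phi [phiL phif phiS]] := exists_face_means s L0 fL.
have h0 m : 0 < 2^-1 ^+ m :> R by rewrite exprn_gt0.
exists (fun m x => 2 ^+ m * (phi m (x + 2^-1 ^+ m *: e_ j) - phi m x)); split.
- move=> m x; rewrite normrM ger0_norm ?exprn_ge0// mulrC -ler_pdivlMr ?exprn_gt0//.
  rewrite -exprVn; apply: le_trans (phiL _ _ _) _; rewrite ler_wpM2l//.
  rewrite addrAC subrr add0r; apply: le_trans (norm_delta_le _ _) _.
  by rewrite ger0_norm// ltW.
- move=> m x.
  pose h : R := 2^-1 ^+ m.+1.
  (* The difference over a side [h + h] splits into [D] at two adjacent points, so halving in
     direction [j] is exact like the halving of the face. *)
  pose D y := phi m.+1 (y + h *: e_ j) - phi m.+1 y.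
  have hE : 2^-1 ^+ m = h + h by rewrite /h exprS; lra.
  have uj : uniq (j :: s) by rewrite /= js.
  have -> : letter_mean (fun c : letter =>
      2 ^+ m.+1 * (phi m.+1 (x + h *: vec_of R c + h *: e_ j)
                   - phi m.+1 (x + h *: vec_of R c))) =
      2 ^+ m.+1 * foldr (pair_mean h) D (j :: s) x.
    rewrite letter_meanZ pair_mean_foldr//; congr (_ * _).
    rewrite /letter_mean card_letter natrX -exprVn /= ss prednK; last first.
      exact: leq_ltn_trans (ltn_ord j).
    congr (_ * _); apply: eq_bigl => c; apply/esym/forallP => i; apply/implyP => _.
    rewrite inE; have [//|ij] := eqVneq i j.
    by rewrite /s mem_rem_uniq ?enum_uniq// !inE ij mem_enum.
  rewrite exprSr -mulrA; congr (_ * _).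
  rewrite [X in 2 * X]/= {1}/pair_mean mulrA mulfV// mul1r.
  rewrite phiS !pair_mean_foldr// -/h -mulrBr -mulrDr -sumrB -big_split /=.
  congr (_ * _); apply: eq_bigr => c _; rewrite /D.
  rewrite hE scalerDl; set u := h *: e_ j; set v := h *: _.
  have -> : x + (u + u) + v = x + u + v + u by rewrite -!addrA (addrC v).
  rewrite [x + v + u]addrAC; ring.
- move=> m x K.
  rewrite -mulr_sumr mulrA -exprMn mulVf// expr1n mul1r.
  have -> : \sum_(t < K) (phi m (x + (t%:R * 2^-1 ^+ m) *: e_ j + 2^-1 ^+ m *: e_ j)
       - phi m (x + (t%:R * 2^-1 ^+ m) *: e_ j)) =
     phi m (x + (K%:R * 2^-1 ^+ m) *: e_ j) - phi m x.
    elim: K => [|K IH]; first by rewrite big_ord0 mul0r scale0r addr0 subrr.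
    have E : x + (K%:R * 2^-1 ^+ m) *: e_ j + 2^-1 ^+ m *: e_ j =
             x + (K.+1%:R * 2^-1 ^+ m) *: e_ j.
      by rewrite -addrA -scalerDl -[K.+1%:R]natr1 mulrDl mul1r.
    rewrite big_ord_recr /= IH E; ring.
  (* After telescoping only the two extreme faces remain, each mean being within
     [n%:R * L * 2^-1 ^+ m] of the value of [f] at the corner. *)
  set y := x + _.
  have -> : phi m y - phi m x - (f y - f x) = (phi m y - f y) - (phi m x - f x) by ring.
  apply: le_trans (ler_normB _ _) _.
  apply: le_trans (lerD (phif m y) (phif m x)) _.
  have : (size s)%:R <= n%:R :> R by rewrite ler_nat.
  have : 0 <= L * 2^-1 ^+ m by rewrite mulr_ge0// ltW.
  nra.
Qed.

End mean_slopes.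

(** * Rademacher's theorem *)

Section walking_along_columns.
Context (R : realType) (n : nat).
Local Notation V := 'rV[R]_n.
Local Notation letter := {ffun 'I_n -> bool}.
Local Notation e_ i := (delta_mx ord0 i : V).
Implicit Types (x y : V) (f : V -> R).

Definition lattice m x := forall i, exists k : int, 2 ^+ m * x ord0 i = k%:~R.

(** The points [u] and [v] are moved to the corners [z] and [z'] of their cubes, which lie [K] steps
    apart in one column; the slopes of the cubes between them add up to the increment of [f]. In the
    error, [2 * L] comes from moving the endpoints, [2 * n%:R * L] from the two end faces, and the
    norm of [p] plus [e] from replacing [K%:R * h] by the true length. *)
Lemma walk_step f L (a : nat -> V -> R) m (u v : V) j (p e : R) :
  0 <= L -> (forall x y, `|f x - f y| <= L * `|x - y|) ->
  (forall x K, `|2^-1 ^+ m * (\sum_(t < K) a m (x + (t%:R * 2^-1 ^+ m) *: e_ j))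
        - (f (x + (K%:R * 2^-1 ^+ m) *: e_ j) - f x)|
        <= 2 * n%:R * L * 2^-1 ^+ m) ->
  unit_box u -> unit_box v -> (forall i, i != j -> u ord0 i = v ord0 i) ->
  u ord0 j <= v ord0 j -> 0 <= e ->
  (forall c, lattice m c ->
     (forall i, u ord0 i - 2^-1 ^+ m <= c ord0 i <= v ord0 i) ->
     `|a m c - p| <= e) ->
  `|f v - f u - p * (v ord0 j - u ord0 j)| <=
    e * (v ord0 j - u ord0 j) + (2 * L + 2 * n%:R * L + `|p| + e) * 2^-1 ^+ m.
Proof.
move=> L0 fL aP ub vb uv uvj e0 aH.
set h := 2^-1 ^+ m in aP aH *.
have h0 : 0 < h by rewrite exprn_gt0.
have h2 : 2 ^+ m * h = 1 by rewrite -exprMn mulfV// expr1n.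
have pow0 : 0 < 2 ^+ m :> R by rewrite exprn_gt0.
pose z := corner R (address u m); pose z' := corner R (address v m).
have zu i : z ord0 i <= u ord0 i < z ord0 i + h.
  have /andP[a0 a1] := corner_address m i ub; rewrite -/z in a0 a1.
  have ge0 : 0 <= u ord0 i - z ord0 i by rewrite -(pmulr_rge0 _ pow0).
  have ltm : u ord0 i - z ord0 i < h by rewrite -(ltr_pM2l pow0) h2.
  by apply/andP; split; lra.
have zv i : z' ord0 i <= v ord0 i < z' ord0 i + h.
  have /andP[a0 a1] := corner_address m i vb; rewrite -/z' in a0 a1.
  have ge0 : 0 <= v ord0 i - z' ord0 i by rewrite -(pmulr_rge0 _ pow0).
  have ltm : v ord0 i - z' ord0 i < h by rewrite -(ltr_pM2l pow0) h2.
  by apply/andP; split; lra.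
have lat i : exists k, z ord0 i = k%:R * h.
  have [k hk] := corner_lattice R (address u m) i; rewrite size_address -/z in hk.
  by exists k; rewrite -hk mulrAC h2 mul1r.
have lat' i : exists k, z' ord0 i = k%:R * h.
  have [k hk] := corner_lattice R (address v m) i; rewrite size_address -/z' in hk.
  by exists k; rewrite -hk mulrAC h2 mul1r.
have [K KE] : exists K : nat, z' = z + (K%:R * h) *: e_ j.
  have [k hk] := lat j; have [k' hk'] := lat' j.
  have kk : (k <= k')%N.
    rewrite -ltnS -(ltr_nat R) -(ltr_pM2r h0) -natr1 mulrDl mul1r -hk -hk'.
    by have /andP[? ?] := zu j; have /andP[? ?] := zv j; lra.
  exists (k' - k)%N; apply/rowP => i; rewrite !mxE eqxx /=.
  have [->|ij] := eqVneq i j.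
    by rewrite mulr1 natrB// mulrBl -hk -hk'; ring.
  rewrite mulr0 addr0.
  have [l hl] := lat i; have [l' hl'] := lat' i.
  rewrite hl hl'; congr (_%:R * _); apply/eqP; rewrite eqn_leq.
  have /andP[? ?] := zu i; have /andP[? ?] := zv i; have := uv _ ij => uvi.
  by apply/andP; split; rewrite -ltnS -(ltr_nat R) -(ltr_pM2r h0) -natr1 mulrDl mul1r -hl -hl'; lra.
have az t : (t < K)%N -> `|a m (z + (t%:R * h) *: e_ j) - p| <= e.
  move=> tK; apply: aH => i.
    have [k hk] := lat i; exists (k%:Z + (t * (i == j))%:Z).
    rewrite !mxE hk eqxx /=.
    rewrite [LHS](_ : _ = (2 ^+ m * h) * (k%:R + t%:R * (i == j)%:R)); last by ring.
    by rewrite h2 mul1r rmorphD /= -!pmulrn natrM.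
  rewrite !mxE eqxx /=; have /andP[? ?] := zu i; have /andP[? ?] := zv i.
  have [ij|ij] := eqVneq i j; last first.
    by rewrite mulr0 addr0 -(uv _ ij); apply/andP; split; lra.
  have : z' ord0 i = z ord0 i + K%:R * h by rewrite KE !mxE ij !eqxx mulr1.
  have : t%:R * h <= K%:R * h by rewrite ler_pM2r// ler_nat ltnW.
  have : 0 <= t%:R * h by rewrite mulr_ge0// ltW.
  by rewrite mulr1 => *; apply/andP; split; lra.
have h4 := aP z K; rewrite -KE in h4.
have h5 : `|h * (\sum_(t < K) a m (z + (t%:R * h) *: e_ j)) - p * (K%:R * h)|
    <= e * (K%:R * h).
  have -> : p * (K%:R * h) = h * \sum_(t < K) p.
    by rewrite sumr_const card_ord -[p *+ K]mulr_natl; ring.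
  rewrite -mulrBr -sumrB normrM gtr0_norm// mulrA [leRHS]mulrC ler_pM2l//.
  apply: le_trans (ler_norm_sum _ _ _) _.
  apply: le_trans (_ : \sum_(t < K) e <= _); first by apply: ler_sum => t _; apply: az.
  by rewrite sumr_const card_ord -[e *+ K]mulr_natl mulrC.
have dist1 x y : (forall i, y ord0 i <= x ord0 i < y ord0 i + h) -> `|f x - f y| <= L * h.
  move=> xy; apply: le_trans (fL _ _) _; rewrite ler_wpM2l//.
  apply: norm_row_le; first exact: ltW.
  by move=> i; rewrite !mxE ger0_norm; have /andP[? ?] := xy i; lra.
have h6 := dist1 _ _ zu; have h7 := dist1 _ _ zv.
have zzj : z' ord0 j = z ord0 j + K%:R * h by rewrite KE !mxE !eqxx mulr1.
have /andP[zu1 zu2] := zu j; have /andP[zv1 zv2] := zv j.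
have Kh : `|K%:R * h - (v ord0 j - u ord0 j)| <= h by rewrite ler_norml; apply/andP; split; lra.
have h8 : `|p * (K%:R * h) - p * (v ord0 j - u ord0 j)| <= `|p| * h.
  by rewrite -mulrBr normrM ler_wpM2l.
have h9 : e * (K%:R * h) <= e * (v ord0 j - u ord0 j) + e * h.
  by rewrite -mulrDr ler_wpM2l//; lra.
move: h4 h5 h6 h7 h8; rewrite !ler_norml => /andP[? ?] /andP[? ?] /andP[? ?] /andP[? ?] /andP[? ?].
by apply/andP; split; lra.
Qed.
End walking_along_columns.

Section rademacher_theorem.
Context (R : realType) (n : nat).
Local Notation V := 'rV[R]_n.
Local Notation letter := {ffun 'I_n -> bool}.
Local Notation e_ i := (delta_mx ord0 i : V).
Implicit Types (x y : V) (f : V -> R).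

Definition inner_box : set V := [set x | forall i, 3^-1 <= x ord0 i <= 2 / 3].

Definition taylor1 f x (p : 'I_n -> R) y :=
  f y - f x - \sum_i p i * (y ord0 i - x ord0 i).

Definition differential_at f x (p : 'I_n -> R) :=
  forall e : R, 0 < e -> exists2 del, 0 < del &
    forall y, `|y - x| < del -> `|taylor1 f x p y| <= e * `|y - x|.

Lemma inner_box_sub_unit_box : inner_box `<=` @unit_box R n.
Proof. by move=> x xi i; have /andP[? ?] := xi i; apply/andP; split; lra. Qed.

(* Near a point of density, every dyadic cube of side comparable to the
   distance to [x] meets [G], so walking from [x] to [y] one coordinate at a
   time only crosses cubes whose mean slope is close to [p]. *)
Lemma taylor1_of_density f L (a : 'I_n -> nat -> V -> R) (G : set V) M x
    (p : 'I_n -> R) (e : R) :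
  0 <= L -> (forall x y, `|f x - f y| <= L * `|x - y|) ->
  (forall j m x K, `|2^-1 ^+ m * (\sum_(t < K) a j m (x + (t%:R * 2^-1 ^+ m) *: e_ j))
        - (f (x + (K%:R * 2^-1 ^+ m) *: e_ j) - f x)|
        <= 2 * n%:R * L * 2^-1 ^+ m) ->
  inner_box x -> G `<=` @unit_box R n -> dense_at (@sup_dist R n) (@unit_box R n) G x ->
  0 < e -> (forall j, `|p j| <= L) ->
  (forall g m j, G g -> (M <= m)%N -> `|a j m (corner R (address g m)) - p j| <= e) ->
  exists2 del, 0 < del & forall y, `|y - x| < del ->
    `|taylor1 f x p y| <= n%:R * (3 * e) * `|y - x|.
Proof.
move=> L0 fL aP xi Gb Gx e0 pL aG.
pose A : R := 3 * L + 2 * n%:R * L + e.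
have nL : 0 <= 2 * n%:R * L by rewrite !mulr_ge0.
have A0 : 0 < A by rewrite /A; lra.
(* With [rho] the norm of [y - x], the walk uses cubes of side [h] between [7 * eta * rho] and
   [14 * eta * rho]: half a side exceeds the density error [2 * eta * rho], so each cube meets [G],
   and yet [A * h <= e * rho], where [A] bounds the coefficient of [h] in [walk_step]. *)
pose eta : R := Num.min (e / (14 * A)) 14^-1.
have eta0 : 0 < eta by rewrite lt_min divr_gt0//= ?mulr_gt0// invr_gt0.
have eta14 : 14 * eta <= 1.
  have : eta <= 14^-1 by rewrite ge_min lexx orbT.
  by lra.
have etaA : 14 * eta * A <= e.
  have : eta <= e / (14 * A) by rewrite ge_min lexx.
  by rewrite ler_pdivlMr ?mulr_gt0//; lra.
have hA : 2 * L + 2 * n%:R * L + L + e <= A by rewrite /A; lra.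
clearbody A eta.
have [d1 d10 hd1] := Gx _ eta0.
pose hM : R := 2^-1 ^+ M.
have hM0 : 0 < hM by rewrite exprn_gt0.
(* Cube centres stay within [2 * rho] of [x], whence [d1 / 2]; [1 / 14] keeps them in the unit box,
   and [hM / 14] forces the level to be at least [M]. *)
pose del := Num.min (d1 / 2) (Num.min (1 / 14) (hM / 14)).
have del0 : 0 < del by rewrite !lt_min !divr_gt0.
exists del => // y yx.
have [d_d1 d_14 d_M] : [/\ del <= d1 / 2, del <= 1 / 14 & del <= hM / 14].
  by rewrite /del; split; rewrite !ge_min lexx ?orbT.
have [->|xy] := eqVneq y x.
  rewrite /taylor1 subrr big1 ?subrr ?normr0 ?mulr_ge0// => [|i _].
    by rewrite ltW// mulr_gt0.
  by rewrite subrr mulr0.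
have yxi i : `|y ord0 i - x ord0 i| <= `|y - x|.
  by have := coord_norm_le (y - x) i; rewrite !mxE.
have rho_gt0 : 0 < `|y - x| by rewrite normr_gt0 subr_eq0.
set rho := `|y - x| in yx yxi rho_gt0 *.
clearbody rho del.
have rho0 := ltW rho_gt0.
have rho14 : rho < 1 / 14 := lt_le_trans yx d_14.
have rho_d1 : 2 * rho < d1.
  by rewrite mulrC -ltr_pdivlMr//; exact: lt_le_trans yx d_d1.
have rho_M : rho < hM / 14 := lt_le_trans yx d_M.
clear yx d_14 d_d1 d_M del0 del.
have t0 : 0 < 14 * eta * rho by rewrite !mulr_gt0.
have t_rho : 14 * eta * rho <= rho by rewrite ler_piMl.
have t1 : 14 * eta * rho <= 1 by lra.
have [m [mle mge]] := dyadic_scale t0 t1.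
pose h : R := 2^-1 ^+ m.
have hE : 2^-1 ^+ m = h by [].
have h0 : 0 < h by rewrite exprn_gt0.
rewrite hE in mle mge.
have h_rho : h <= rho by lra.
have h_eta : eta * (2 * rho) < h / 2 by lra.
have Mm : (M <= m)%N.
  rewrite leqNgt; apply/negP => mM.
  have : hM <= h / 2.
    rewrite /hM /h -(subnKC mM) exprD exprSr ler_piMr ?mulr_ge0//.
    by apply: exprn_ile1; clear; lra.
  by move: h_rho rho_M hM0; clear; lra.
clearbody h hM.
pose pt k : V := \row_i (if (i < k)%N then y ord0 i else x ord0 i).
have ptx k i : `|pt k ord0 i - x ord0 i| <= rho.
  by rewrite mxE; case: ifP => // _; rewrite subrr normr0.
have ptb k : unit_box (pt k).
  move=> i; have := ptx k i; have /andP[] := xi i; rewrite ler_norml.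
  move: rho14; clear => ? ? ? /andP[? ?].
  by apply/andP; split; lra.
have aclose (u v : V) j : (forall i, `|u ord0 i - x ord0 i| <= rho) ->
   (forall i, `|v ord0 i - x ord0 i| <= rho) ->
   forall c, lattice m c ->
     (forall i, u ord0 i - 2^-1 ^+ m <= c ord0 i <= v ord0 i) ->
     `|a j m c - p j| <= e.
  move=> ux vx c cl uc; rewrite hE in uc.
  (* The centre of the cube with corner [c]: a point of [G] closer than [h / 2] in sup norm lies in
     that cube, so its slope is the one controlled on [G]. *)
  pose z : V := \row_i (c ord0 i + h / 2).
  have zx i : `|x ord0 i - z ord0 i| <= 2 * rho.
    have := ux i; have := vx i; have /andP[] := uc i.
    rewrite mxE !ler_norml; move: h_rho h0; clear => ? ? ? ? /andP[? ?] /andP[? ?].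
    by apply/andP; split; lra.
  have zb : unit_box z.
    move=> i; have := zx i; have /andP[] := xi i; rewrite ler_norml.
    move: rho14; clear => ? ? ? /andP[? ?].
    by apply/andP; split; lra.
  have nzx : `|x - z| <= 2 * rho.
    by apply: norm_row_le => [|i]; [rewrite mulr_ge0|rewrite !mxE; have := zx i; rewrite mxE].
  have [g Gg zg] := hd1 z zb (le_lt_trans nzx rho_d1).
  have gz i : `|z ord0 i - g ord0 i| < h / 2.
    apply: le_lt_trans (_ : `|z - g| < _); first by have := coord_norm_le (z - g) i; rewrite !mxE.
    apply: le_lt_trans h_eta; apply: le_trans zg _.
    by rewrite ler_pM2l.
  have -> : c = corner R (address g m).
    apply/esym/corner_address_eq => // [|i]; first exact: Gb.
    have h2 : 2 ^+ m * h = 1 by rewrite -hE -exprMn mulfV// expr1n.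
    have pow0 : 0 < 2 ^+ m :> R by rewrite exprn_gt0.
    rewrite -[X in _ < X]h2 ltr_pM2l// pmulr_rge0//.
    have := gz i; rewrite mxE ltr_norml; clear => /andP[? ?].
    by apply/andP; split; lra.
  exact: aG.
have step (k : 'I_n) : `|f (pt k.+1) - f (pt k) - p k * (y ord0 k - x ord0 k)| <= 3 * e * rho.
  have ptk : pt k ord0 k = x ord0 k by rewrite mxE ltnn.
  have ptk1 : pt k.+1 ord0 k = y ord0 k by rewrite mxE ltnSn.
  have pte i : i != k -> pt k ord0 i = pt k.+1 ord0 i.
    by move=> /negbTE ik; rewrite !mxE ltnS [(i <= k)%N]leq_eqVlt (ik : (i == k :> nat) = false).
  have bound w : `|w| <= rho -> e * `|w| + (2 * L + 2 * n%:R * L + `|p k| + e) * h <= 3 * e * rho.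
    move=> wr; have := pL k => pk.
    have b1 : (2 * L + 2 * n%:R * L + `|p k| + e) * h <= A * h.
      rewrite ler_pM2r//; apply: le_trans hA.
      by rewrite lerD2r lerD2l.
    have b2 : A * h <= e * rho.
      apply: le_trans (_ : A * (14 * eta * rho) <= _); first by rewrite ler_pM2l.
      by rewrite mulrA ler_pM2r// mulrC.
    have b3 : e * `|w| <= e * rho by rewrite ler_pM2l.
    have b4 : 0 <= e * rho by rewrite mulr_ge0// ltW.
    by move: b1 b2 b3 b4; clear; lra.
  have [uv|uv] := leP (x ord0 k) (y ord0 k).
    have := @walk_step _ _ f L (a k) m (pt k) (pt k.+1) k (p k) e L0 fL (aP k m)
      (ptb _) (ptb _) pte _ (ltW e0) (aclose _ _ k (ptx _) (ptx _)).
    rewrite ptk ptk1 hE => /(_ uv) /le_trans; apply.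
    rewrite -{1}(ger0_norm (_ : 0 <= y ord0 k - x ord0 k)) ?subr_ge0//.
    exact: bound (yxi k).
  (* If the coordinate decreases, the same column is walked backwards. *)
  have := @walk_step _ _ f L (a k) m (pt k.+1) (pt k) k (p k) e L0 fL (aP k m)
      (ptb _) (ptb _) _ _ (ltW e0) (aclose _ _ k (ptx _) (ptx _)).
  rewrite ptk ptk1 hE => /(_ _ (ltW uv)) h1.
  rewrite (_ : _ - _ - _ = - (f (pt k) - f (pt k.+1) - p k * (x ord0 k - y ord0 k))); last by ring.
  rewrite normrN; apply: le_trans (h1 _) _; first by move=> i /pte.
  have xy0 : 0 <= x ord0 k - y ord0 k by rewrite subr_ge0 ltW.
  rewrite -{1}(ger0_norm xy0).
  by apply: bound; rewrite distrC.
have -> : taylor1 f x p y =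
    \sum_(k < n) (f (pt k.+1) - f (pt k) - p k * (y ord0 k - x ord0 k)).
  rewrite sumrB /taylor1; congr (_ - _).
  rewrite -(big_mkord xpredT (fun k => f (pt k.+1) - f (pt k))) telescope_sumr//.
  congr (f _ - f _); apply/rowP => i; rewrite mxE ?ltn_ord//.
apply: le_trans (ler_norm_sum _ _ _) _.
apply: le_trans (_ : \sum_(k < n) 3 * e * rho <= _); first by apply: ler_sum => k _; exact: step.
by rewrite sumr_const card_ord -[leLHS]mulr_natl mulrA.
Qed.
End rademacher_theorem.

Lemma null_bigcup_countType (R : realType) (n : nat) (n_gt0 : (0 < n)%N)
    (T : Type) (d : T -> T -> R) (I : countType) (A : I -> set T) :
  (forall i, null n d (A i)) -> null n d (\bigcup_i A i).
Proof.
move=> nA; pose B k := if unpickle k is Some i then A i else set0.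
apply: (@sub_null _ _ _ _ _ (\bigcup_k B k)).
  by move=> x [i _ Aix]; exists (pickle i) => //; rewrite /B pickleK.
apply: null_bigcup => // k; rewrite /B; case: (unpickle k) => [i|]; first exact: nA.
move=> e e0; exists (fun=> set0), (fun=> 0); split => //.
by move=> N; rewrite big1 ?ltW// => i _; rewrite expr0n eqn0Ngt n_gt0.
Qed.

Lemma cvg_of_small_oscillation (R : realType) (u : nat -> R) :
  (forall e : R, 0 < e -> exists M, forall m, (M <= m)%N -> `|u m - u M| <= e) ->
  exists l, forall e : R, 0 < e -> exists M, forall m, (M <= m)%N -> `|u m - l| <= e.
Proof.
move=> ucau.
have ul : cvg (u @ \oo).
  apply/cauchy_cvgP/cauchy_exP => e e0.
  have e20 : 0 < e / 2 by rewrite divr_gt0.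
  have [M hM] := ucau _ e20; exists (u M).
  exists M => // m /= Mm; rewrite /ball /= distrC.
  by apply: le_lt_trans (hM m Mm) _; lra.
exists (lim (u @ \oo)) => e e0.
have /cvgrPdist_le/(_ _ e0)[M _ hM] := ul; exists M => m Mm.
by rewrite distrC; exact: hM.
Qed.

Section rademacher_ae.
Context (R : realType) (n : nat) (n_gt0 : (0 < n)%N).
Local Notation V := 'rV[R]_n.
Local Notation letter := {ffun 'I_n -> bool}.

Theorem rademacher (f : V -> R) (L : R) : 0 <= L ->
  (forall x y, `|f x - f y| <= L * `|x - y|) ->
  null n (@sup_dist R n) [set x | @inner_box R n x /\ ~ exists p, differential_at f x p].
Proof.
move=> L0 fL.
have /choice[a ha] := fun j => exists_mean_slopes j L0 fL.
have aL j m x : `|a j m x| <= L by case: (ha j).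
have aP j m x K : `|2^-1 ^+ m * (\sum_(t < K) a j m (x + (t%:R * 2^-1 ^+ m) *: delta_mx ord0 j))
        - (f (x + (K%:R * 2^-1 ^+ m) *: delta_mx ord0 j) - f x)|
        <= 2 * n%:R * L * 2^-1 ^+ m by case: (ha j).
pose aw j (w : seq letter) := a j (size w) (corner R w).
have mar j : martingale (aw j).
  move=> w; rewrite /aw; have [_ -> _] := ha j; apply: eq_letter_mean => c.
  by rewrite corner_rcons size_rcons.
have awE j (x : V) m : aw j (address x m) = a j m (corner R (address x m)).
  by rewrite /aw size_address.
pose N1 (jk : 'I_n * nat) := [set x : V | unit_box x /\ forall M, exists2 m, (M <= m)%N &
   jk.2.+1%:R^-1 / 2 < `|aw jk.1 (address x m) - aw jk.1 (address x M)|].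
(* Indexing by the word at which the slopes settle gives all points of a piece the same reference
   slope, and leaves only countably many pieces. *)
pose G (ku : nat * seq letter) := [set x : V | [/\ unit_box x, address x (size ku.2) = ku.2 &
   forall j m, (size ku.2 <= m)%N -> `|aw j (address x m) - aw j ku.2| <= ku.1.+1%:R^-1]].
pose N2 ku := [set x : V | G ku x /\ ~ dense_at (@sup_dist R n) (@unit_box R n) (G ku) x].
have nN1 jk : null n (@sup_dist R n) (N1 jk).
  apply: (null_martingale_oscillation n_gt0 (mar jk.1) (B := L)).
    by move=> w; exact: aL.
  by rewrite divr_gt0// invr_gt0.
have nN2 ku : null n (@sup_dist R n) (N2 ku).
  by apply: null_not_dense_in_unit_box => // x [].
apply: sub_null (nullU n_gt0 (null_bigcup_countType n_gt0 nN1)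
  (null_bigcup_countType n_gt0 nN2)) => x [xi].
apply: contra_notP => /not_orP[h1 h2].
have xb := inner_box_sub_unit_box xi.
have osc j k : exists M, forall m, (M <= m)%N ->
    `|aw j (address x m) - aw j (address x M)| <= k.+1%:R^-1 / 2.
  apply: contrapT => h; apply: h1; exists (j, k) => //; split => // M.
  apply: contrapT => h3; apply: h; exists M => m Mm.
  by rewrite leNgt; apply/negP => h4; apply: h3; exists m.
have inG k : exists M, G (k, address x M) x.
  have /choice[M hM] := osc ^~ k.
  exists (\max_j M j); split => //=; rewrite size_address// => j m Mm.
  have Mj : (M j <= \max_j M j)%N by exact: leq_bigmax.
  rewrite -(subrKA (aw j (address x (M j)))).
  apply: le_trans (ler_normD _ _) _.
  rewrite [X in _ <= X]splitr; apply: lerD; first exact: hM (leq_trans Mj Mm).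
  by rewrite distrC; exact: hM.
have /choice[p hp] j : exists l, forall e : R, 0 < e -> exists M, forall m, (M <= m)%N ->
    `|aw j (address x m) - l| <= e.
  apply: (cvg_of_small_oscillation (u := fun m => aw j (address x m))) => e e0.
  have [k hk] := ltr_add_invr e0; rewrite add0r in hk.
  have [M hM] := osc j k; exists M => m Mm; apply: le_trans (hM m Mm) _.
  by apply: ltW; apply: le_lt_trans hk; rewrite ler_pdivrMr// ler_peMr// ler1n.
exists p => e e0.
(* A share [3 * n%:R] comes from the Taylor estimate with the reference slopes [q], and [n%:R] from
   replacing [q] by the limits [p]. *)
pose C : R := n%:R * 4.
have C0 : 0 < C by rewrite mulr_gt0// ltr0n.
have eC0 : 0 < e / C by rewrite divr_gt0.
have [k hk] := ltr_add_invr eC0; rewrite add0r in hk.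
have [M GM] := inG k; pose q j := aw j (address x M).
have k0 : 0 < k.+1%:R^-1 :> R by rewrite invr_gt0.
have pq j : `|q j - p j| <= k.+1%:R^-1.
  apply/ler_addgt0Pl => e' e'0; have [M' hM'] := hp j _ e'0.
  have [_ _ Gx] := GM; rewrite /= size_address in Gx.
  rewrite -(subrKA (aw j (address x (maxn M M')))).
  apply: le_trans (ler_normD _ _) _; rewrite addrC; apply: lerD.
    by apply: hM'; exact: leq_maxr.
  by rewrite distrC; apply: Gx; exact: leq_maxl.
have Gd : dense_at (@sup_dist R n) (@unit_box R n) (G (k, address x M)) x.
  by apply: contrapT => nd; apply: h2; exists (k, address x M).
have [del del0 hdel] := @taylor1_of_density _ _ f L a (G (k, address x M)) M x q _
  L0 fL aP xi ltac:(by move=> y []) Gd k0 (fun j => aL j _ _)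
  ltac:(by move=> g m j [_ _ Gg] Mm; rewrite -awE; apply: Gg; rewrite /= size_address).
exists del => // y yx.
have -> : taylor1 f x p y = taylor1 f x q y + \sum_i (q i - p i) * (y ord0 i - x ord0 i).
  have E : \sum_i p i * (y ord0 i - x ord0 i) =
      \sum_i q i * (y ord0 i - x ord0 i) - \sum_i (q i - p i) * (y ord0 i - x ord0 i).
    by rewrite -sumrB; apply: eq_bigr => i _; ring.
  by rewrite /taylor1 E; ring.
apply: le_trans (ler_normD _ _) _.
apply: le_trans (lerD (hdel y yx) (ler_norm_sum _ _ _)) _.
apply: le_trans (_ : n%:R * (3 * k.+1%:R^-1) * `|y - x| + \sum_(i < n) k.+1%:R^-1 * `|y - x| <= _).
  rewrite lerD2l; apply: ler_sum => i _; rewrite normrM ler_pM//.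
  by have := coord_norm_le (y - x) i; rewrite !mxE.
rewrite sumr_const card_ord -[_ *+ n]mulr_natl.
rewrite (_ : _ + _ = k.+1%:R^-1 * C * `|y - x|); last by rewrite /C; ring.
by rewrite ler_wpM2r// -ler_pdivlMr// ltW.
Qed.
End rademacher_ae.

(** * Critical values *)

Section vector_valued_maps.
Context (R : realType) (n d : nat).
Local Notation V := 'rV[R]_n.
Local Notation W := 'rV[R]_d.
Implicit Types (x y : V) (F : V -> W) (D : 'M[R]_(n, d)).

Definition has_differential F x D :=
  forall e : R, 0 < e -> exists2 del, 0 < del &
    forall y, `|y - x| < del -> `|F y - F x - (y - x) *m D| <= e * `|y - x|.

Lemma mulmx_norm_le (D : 'M[R]_(n, d)) : exists2 C : R, 0 < C &
  forall x : V, `|x *m D| <= C * `|x|.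
Proof.
exists (1 + \sum_i \sum_j `|D i j|) => [|x].
  by rewrite ltr_pwDl// sumr_ge0// => i _; rewrite sumr_ge0.
apply: norm_row_le => [|j].
  by rewrite mulr_ge0// addr_ge0// sumr_ge0// => i _; rewrite sumr_ge0.
rewrite mxE; apply: le_trans (ler_norm_sum _ _ _) _.
apply: le_trans (_ : (\sum_i \sum_j `|D i j|) * `|x| <= _); last first.
  by rewrite ler_wpM2r// lerDr.
rewrite mulr_suml; apply: ler_sum => i _; rewrite normrM mulrC.
rewrite ler_pM ?coord_norm_le//.
by rewrite (bigD1 j)//= lerDl sumr_ge0.
Qed.

(** Test the expansion with error 1 on a multiple of [v] of norm [del / 2]. *)
Lemma norm_differential_le F L x D : 0 <= L ->
  (forall x y, `|F x - F y| <= L * `|x - y|) ->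
  has_differential F x D -> forall v : V, `|v *m D| <= (L + 1) * `|v|.
Proof.
move=> L0 FL FD v; have [->|v0] := eqVneq v 0.
  by rewrite mul0mx !normr0 mulr0.
have [del del0 hdel] := FD 1 ltr01.
have nv0 : 0 < `|v| by rewrite normr_gt0.
pose t := del / (2 * `|v|).
have t0 : 0 < t by rewrite divr_gt0// mulr_gt0.
have tv : `|t *: v| = t * `|v| by rewrite normrZ gtr0_norm.
have := hdel (x + t *: v); have := FL (x + t *: v) x.
rewrite [x + _ - x]addrAC subrr add0r tv mul1r -scalemxAl.
have -> : t * `|v| = del / 2 by rewrite /t; field; rewrite gt_eqF.
move=> h1 /(_ _) h2.
have {}h2 : `|F (x + t *: v) - F x - t *: (v *m D)| <= del / 2 by apply: h2; lra.
rewrite -(ler_pM2l t0) mulrCA -/t.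
have -> : (L + 1) * (t * `|v|) = L * (del / 2) + del / 2.
  by rewrite /t; field; rewrite gt_eqF.
rewrite -{1}(gtr0_norm t0) -normrZ.
rewrite -(subKr (F (x + t *: v) - F x) (t *: (v *m D))).
by apply: le_trans (ler_normB _ _) _; exact: lerD.
Qed.

Hypothesis n_gt0 : (0 < n)%N.

Lemma rademacher_vector F L : 0 <= L ->
  (forall x y, `|F x - F y| <= L * `|x - y|) ->
  null n (@sup_dist R n)
    [set x | @inner_box R n x /\ ~ exists D, has_differential F x D].
Proof.
move=> L0 FL.
have FlL l x y : `|F x ord0 l - F y ord0 l| <= L * `|x - y|.
  by apply: le_trans (FL x y); have := coord_norm_le (F x - F y) l; rewrite !mxE.
have nl (l : 'I_d) := rademacher n_gt0 L0 (FlL l).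
apply: sub_null (null_bigcup_countType n_gt0 nl) => x [xi].
apply: contra_notP => h.
have /choice[p hp] l : exists p, differential_at (fun y => F y ord0 l) x p.
  by apply: contrapT => hl; apply: h; exists l.
exists (\matrix_(i, l) p l i) => e e0.
have /choice[del hdel] l : exists del, 0 < del /\ forall y, `|y - x| < del ->
   `|taylor1 (fun y => F y ord0 l) x (p l) y| <= e * `|y - x|.
  by have [del ? ?] := hp l e e0; exists del.
exists (\big[Num.min/1]_l del l) => [|y yx].
  by rewrite lt_bigmin// => l _; case: (hdel l).
apply: norm_row_le => [|l]; first by rewrite mulr_ge0// ltW.
have -> : (F y - F x - (y - x) *m \matrix_(i, l) p l i) ord0 l =
    taylor1 (fun y => F y ord0 l) x (p l) y.
  rewrite /taylor1 !mxE; congr (_ - _); apply: eq_bigr => i _.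
  by rewrite !mxE mulrC.
have [_] := hdel l; apply; apply: lt_le_trans yx _; exact: bigmin_le.
Qed.

End vector_valued_maps.

Section sard.
Context (R : realType) (n d : nat).
Local Notation V := 'rV[R]_n.+1.
Local Notation W := 'rV[R]_d.
Local Notation letter := {ffun 'I_n.+1 -> bool}.
Implicit Types (x y : V) (F : V -> W) (D : 'M[R]_(n.+1, d)).

(** The image of the cube is cut into [K.+1 ^ n] parts of diameter at most [C / K.+1%:R] times the
    side, one factor [K.+1] fewer than a cube of dimension [n.+1] would need; this gain makes
    critical values null. *)
Let collapsed F (C : R) K (w : seq letter) :=
  exists cell : V -> {ffun 'I_n -> 'I_K.+1}, forall y z,
    unit_box y -> unit_box z -> address y (size w) = w -> address z (size w) = w ->
    cell y = cell z -> `|F y - F z| <= C / K.+1%:R * 2^-1 ^+ size w.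

(* Subtracting a multiple of a kernel vector [w] kills one coordinate of [y - x]
   without changing its image under [D], so [n] coordinates determine the cell. *)
Lemma collapsed_of_kernel F L K x D (w : V) : 0 <= L ->
  (forall x y, `|F x - F y| <= L * `|x - y|) ->
  unit_box x -> has_differential F x D -> w != 0 -> w *m D = 0 ->
  exists m, collapsed F (5 * L + 7) K (address x m).
Proof.
move=> L0 FL xb FD w0 wD.
(* A coordinate of largest modulus: normalised there, the kernel vector has coordinates at most 1,
   so [pr] at most doubles the norm. *)
have [j wj] : exists j, `|w ord0 j| = `|w|.
  have nz : mx_norm w != 0 by rewrite -[mx_norm w]/(`|w|) normr_eq0.
  have [[i j] ij] := mx_norm_neq0 nz.
  by exists j; rewrite [RHS]ij /= (ord1 i).
have wj0 : w ord0 j != 0 by rewrite -normr_eq0 wj normr_eq0.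
pose v := (w ord0 j)^-1 *: w.
have vj : v ord0 j = 1 by rewrite mxE mulVf.
have vD : v *m D = 0 by rewrite -scalemxAl wD scaler0.
have v1 i : `|v ord0 i| <= 1.
  rewrite mxE normrM normfV wj mulrC ler_pdivrMr ?normr_gt0// mul1r.
  exact: coord_norm_le.
have K0 : 0 < K.+1%:R^-1 :> R by rewrite invr_gt0.
have DL := norm_differential_le L0 FL FD.
have [del del0 hdel] := FD _ K0.
have [m hm] : exists m, 2^-1 ^+ m < del.
  have [m hm] := ltr_add_invr del0; rewrite add0r in hm.
  exists m; apply: le_lt_trans hm.
  rewrite exprVn lef_pV2 ?posrE ?exprn_gt0// -natrX ler_nat.
  exact: ltn_expl.
exists m; pose h : R := 2^-1 ^+ m.
have h0 : 0 < h by rewrite exprn_gt0.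
pose pr y := (y - x) - (y ord0 j - x ord0 j) *: v.
have prj y : pr y ord0 j = 0 by rewrite !mxE -/(v ord0 j) mulVf// mulr1 subrr.
have prD y : pr y *m D = (y - x) *m D by rewrite mulmxBl -scalemxAl vD scaler0 subr0.
(* Coordinates of [pr], shifted by [2 * h], lie between 0 and [4 * h]; cutting the longer interval
   of length [5 * h] into [K.+1] steps keeps every index below [K.+1]. *)
pose s := 5 * h / K.+1%:R.
have s0 : 0 < s by rewrite divr_gt0// mulr_gt0.
exists (fun y => [ffun i => inord (Num.truncn ((pr y ord0 (lift j i) + 2 * h) / s))]).
rewrite size_address => y z yb zb ya za yz.
have near u : unit_box u -> address u m = address x m -> `|u - x| <= h.
  by move=> ub ux; apply: address_eq_dist.
have yx := near y yb ya; have zx := near z zb za.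
have pr2 u i : `|u - x| <= h -> `|pr u ord0 i| <= 2 * h.
  move=> ux; have c i' : `|u ord0 i' - x ord0 i'| <= h.
    by apply: le_trans ux; have := coord_norm_le (u - x) i'; rewrite !mxE.
  have -> : pr u ord0 i = (u ord0 i - x ord0 i) - (u ord0 j - x ord0 j) * v ord0 i.
    by rewrite !mxE.
  apply: le_trans (ler_normB _ _) _.
  rewrite (_ : 2 * h = h + h * 1); last by ring.
  by apply: lerD => //; rewrite normrM ler_pM.
have trunc u i : `|u - x| <= h ->
    (Num.truncn ((pr u ord0 i + 2 * h) / s))%:R <= (pr u ord0 i + 2 * h) / s
      < (Num.truncn ((pr u ord0 i + 2 * h) / s)).+1%:R
    /\ (Num.truncn ((pr u ord0 i + 2 * h) / s) < K.+1)%N.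
  move=> ux; have := pr2 u i ux; rewrite ler_norml => /andP[p1 p2].
  have q0 : 0 <= (pr u ord0 i + 2 * h) / s.
    by apply: divr_ge0; [move: p1; clear; lra|exact: ltW].
  have itv := truncn_itv q0; split => //.
  rewrite -(ltr_nat R); have /andP[t1 _] := itv; apply: le_lt_trans t1 _.
  rewrite ltr_pdivrMr// /s mulrCA mulfV// mulr1.
  by move: p2 h0; clear; lra.
have prK : `|pr y - pr z| <= s.
  apply: norm_row_le => [|i]; first exact: ltW.
  rewrite mxE [(- pr z) _ _]mxE.
  case: (unliftP j i) => [i' ->|->]; last by rewrite !prj subrr normr0 ltW.
  have := congr1 (fun c : {ffun 'I_n -> 'I_K.+1} => val (c i')) yz.
  have [/andP[a1 a2] aK] := trunc y (lift j i') yx.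
  have [/andP[b1 b2] bK] := trunc z (lift j i') zx.
  rewrite !ffunE /= !inordK// => E.
  rewrite E in a1 a2; move: a1 a2 b1 b2; rewrite -!natr1.
  rewrite ler_pdivlMr// ltr_pdivrMr// ler_pdivlMr// ltr_pdivrMr//.
  rewrite !mulrDl mul1r ler_norml; move: (_ * s) => q; clear => *.
  by apply/andP; split; lra.
have err u : `|u - x| <= h -> `|F u - F x - pr u *m D| <= h / K.+1%:R.
  move=> ux; rewrite prD; apply: le_trans (hdel u (le_lt_trans ux hm)) _.
  by rewrite mulrC ler_wpM2r// ltW.
(* Two expansion errors [h / K.+1%:R] and the term [(L + 1) * s] add up to the constant
   [5 * L + 7]. *)
have -> : F y - F z = (F y - F x - pr y *m D) - (F z - F x - pr z *m D) + (pr y - pr z) *m D.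
  rewrite [(pr y - pr z) *m D]mulmxBl; move: (pr y *m D) (pr z *m D) => P Q.
  by apply/rowP => i; rewrite !mxE; ring.
apply: le_trans (ler_normD _ _) _.
apply: le_trans (lerD (le_trans (ler_normB _ _) (lerD (err y yx) (err z zx)))
  (le_trans (DL _) (ler_wpM2l _ prK))) _; first by rewrite addr_ge0.
rewrite -/h /s le_eqVlt; apply/orP; left; apply/eqP; ring.
Qed.

(** On a minimal collapsed cube, [K.+1 ^ n] parts contribute [C ^+ n.+1 / K.+1%:R] times the weight
    of the cube. The weights sum to at most 1 by [kraft], and [K] is as large as desired. *)
Lemma null_critical_values F L : 0 <= L ->
  (forall x y, `|F x - F y| <= L * `|x - y|) ->
  null n.+1 (@sup_dist R d) (F @` [set x | unit_box x /\
    exists D, has_differential F x D /\ exists2 w : V, w != 0 & w *m D = 0]).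
Proof.
move=> L0 FL e e0.
pose C : R := 5 * L + 7.
have C0 : 0 < C by rewrite /C; lra.
have [K hK] : exists K : nat, C ^+ n.+1 / e < K.+1%:R.
  exists (Num.truncn (C ^+ n.+1 / e)); exact: truncnS_gt.
have /choice[cell hcell] w : exists cell : V -> {ffun 'I_n -> 'I_K.+1},
    collapsed F C K w -> forall y z,
    unit_box y -> unit_box z -> address y (size w) = w -> address z (size w) = w ->
    cell y = cell z -> `|F y - F z| <= C / K.+1%:R * 2^-1 ^+ size w.
  have [[c hc]|nc] := pselect (collapsed F C K w); first by exists c.
  by exists (fun=> [ffun=> ord0]).
apply: (@cover_of_countable _ n.+1 isT _ _ (seq letter * {ffun 'I_n -> 'I_K.+1})%type
  [set wc | minimal_word (collapsed F C K) wc.1]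
  (fun wc => F @` [set y | [/\ unit_box y, address y (size wc.1) = wc.1 &
     cell wc.1 y = wc.2]])
  (fun wc => C / K.+1%:R * 2^-1 ^+ size wc.1)).
- exact: countableP.
- by move=> wc _; rewrite mulr_ge0 ?exprn_ge0// divr_ge0// ltW.
- move=> [w c] _ _ [/= wQ _] [y [yb ya <-] <-] [z [zb za zc] <-].
  by apply: hcell.
- move=> _ [x [xb [D [FD [w w0 wD]]]] <-].
  have [m Qm] := collapsed_of_kernel K L0 FL xb FD w0 wD.
  have [k mk] := minimal_word_address Qm.
  exists (address x k, cell (address x k) x) => //=.
  by exists x => //; split => //; rewrite size_address.
- move=> s us hs.
  pose ws := undup [seq wc.1 | wc <- s].
  have uW : uniq ws by exact: undup_uniq.
  have pW : prefix_free ws.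
    apply: (@prefix_free_minimal _ (collapsed F C K)) => w.
    by rewrite mem_undup => /mapP[wc /hs wcs ->].
  pose t := [seq (w, c) | w <- ws, c <- enum {ffun 'I_n -> 'I_K.+1}].
  apply: le_trans (_ : \sum_(wc <- t) (C / K.+1%:R * 2^-1 ^+ size wc.1) ^+ n.+1 <= _).
    apply: (@ler_sum_subset _ _ (fun wc : seq letter * {ffun 'I_n -> 'I_K.+1} => _)) => //.
      by move=> wc; rewrite exprn_ge0// mulr_ge0 ?exprn_ge0// divr_ge0// ltW.
    move=> [w c] wcs; apply/allpairsP; exists (w, c); rewrite mem_enum; split => //.
    by rewrite mem_undup; apply/mapP; exists (w, c).
  rewrite big_allpairs.
  have inner w : \sum_(c <- enum {ffun 'I_n -> 'I_K.+1})
      (C / K.+1%:R * 2^-1 ^+ size (w, c).1) ^+ n.+1 =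
      C ^+ n.+1 / K.+1%:R * #|[the finType of letter]|%:R^-1 ^+ size w.
    rewrite /= big_enum sumr_const card_ffun !card_ord letter_weight.
    move: (2^-1 ^+ size w) => q; rewrite -[LHS]mulr_natl natrX.
    have k0 : K.+1%:R != 0 :> R by rewrite pnatr_eq0.
    move: (K.+1%:R : R) k0 => k k0; rewrite !exprMn exprVn [k ^+ n.+1]exprS.
    have := expf_neq0 n k0; move: (k ^+ n) (C ^+ n.+1) (q ^+ n.+1) => a b c a0.
    transitivity (a / a * (b / k * c)); first by rewrite invfM; ring.
    by rewrite mulfV// mul1r.
  under eq_bigr do rewrite inner.
  rewrite -mulr_sumr; apply: le_trans (_ : C ^+ n.+1 / K.+1%:R * 1 <= _).
    rewrite ler_wpM2l ?divr_ge0 ?exprn_ge0 ?(ltW C0)//.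
    exact: (kraft R (card_letter_gt0 n.+1) uW pW).
  by move: hK; rewrite mulr1 ltr_pdivrMr// ler_pdivrMr// mulrC => /ltW.
Qed.

End sard.

(** * Lipschitz extension and Hausdorff measure *)

Section mcshane.
Context (R : realType) (n : nat).
Local Notation V := 'rV[R]_n.

(** McShane's extension, the infimum of the cones of slope [L] based on the graph of [g]. *)
Lemma lipschitz_extension (A : set V) (g : V -> R) (L : R) : 0 <= L ->
  (forall x y, A x -> A y -> `|g x - g y| <= L * `|x - y|) ->
  exists G : V -> R, (forall x y, `|G x - G y| <= L * `|x - y|) /\
    (forall x, A x -> G x = g x).
Proof.
move=> L0 gL; have [[a0 Aa0]|A0] := pselect (exists a, A a); last first.
  exists (fun=> 0); split => [x y|x Ax]; last by exfalso; apply: A0; exists x.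
  by rewrite subrr normr0 mulr_ge0.
pose X y := [set g a + L * `|y - a| | a in A].
have Xlb y : lbound (X y) (g a0 - L * `|y - a0|).
  move=> _ [a Aa <-]; have := gL _ _ Aa0 Aa; rewrite ler_norml => /andP[_ h1].
  have : L * `|a0 - a| <= L * (`|y - a0| + `|y - a|).
    by rewrite ler_wpM2l// distrC [leRHS]addrC (le_trans (ler_distD y _ _))// (distrC a).
  by rewrite mulrDr; move: h1; clear; lra.
have Xi y : has_inf (X y) by split; [exists (g a0 + L * `|y - a0|), a0|exists (g a0 - L * `|y - a0|); exact: Xlb].
have Xle y a : A a -> inf (X y) <= g a + L * `|y - a|.
  by move=> Aa; apply: inf_lbound; [case: (Xi y)|exists a].
have half x y : inf (X x) - inf (X y) <= L * `|x - y|.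
  rewrite lerBlDl -lerBlDr; apply: lb_le_inf; first by case: (Xi y).
  move=> _ [a Aa <-]; rewrite lerBlDr; apply: le_trans (Xle x a Aa) _.
  rewrite -addrA lerD2l -mulrDr ler_wpM2l// [leRHS]addrC; exact: ler_distD.
exists (fun y => inf (X y)); split => [x y|x Ax].
  by rewrite ler_norml half andbT lerNl opprB distrC half.
apply/eqP; rewrite eq_le; apply/andP; split.
  by apply: le_trans (Xle x x Ax) _; rewrite subrr normr0 mulr0 addr0.
apply: lb_le_inf; first by case: (Xi x).
move=> _ [a Aa <-]; have := gL _ _ Ax Aa; rewrite ler_norml => /andP[_]; clear; lra.
Qed.

End mcshane.

Section hausdorff_null.
Context (R : realType) (n : nat) (n_gt0 : (0 < n)%N).
Local Notation mdistR T := (@mdist R T).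

Lemma mdist_le_diam (T : metricType R) (U : set T) x y : U x -> U y ->
  ((mdist x y)%:E <= diam U)%E.
Proof.
move=> Ux Uy; rewrite /diam le_max; apply/orP; right.
by apply: ereal_sup_ubound; exists x => //; exists y.
Qed.

Lemma diam_le (T : metricType R) (U : set T) (r : R) : 0 <= r ->
  (forall x y, U x -> U y -> mdist x y <= r) -> (diam U <= r%:E)%E.
Proof.
move=> r0 h; rewrite /diam ge_max lee_fin r0 /=; apply: ge_ereal_sup.
by move=> _ [x Ux [y Uy <-]]; rewrite lee_fin; exact: h.
Qed.

Lemma diam_ge0 (T : metricType R) (U : set T) : (0 <= diam U)%E.
Proof. by rewrite /diam le_max lexx. Qed.

Lemma le_hausdorff_content (T : metricType R) (s : R) (A : set T) (a b : R) : a <= b ->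
  (hausdorff_content s A b <= hausdorff_content s A a)%E.
Proof.
move=> ab; apply: le_ereal_inf => _ [U [AU Ua] <-]; exists U => //; split => // i.
by apply: le_trans (Ua i) _; rewrite lee_fin.
Qed.

Lemma hausdorff_content_ge0 (T : metricType R) (s : R) (A : set T) (a : R) :
  (0 <= hausdorff_content s A a)%E.
Proof.
apply: le_ereal_inf_tmp => _ [U _ <-].
by apply: nneseries_ge0 => i _ _; exact: poweR_ge0.
Qed.

(** The content grows as [delta] decreases, so the measure is its supremum and the content at 1
    vanishes too; the bound 1 makes all diameters finite. *)
Lemma null_of_hausdorff_measure (T : metricType R) (A : set T) :
  hausdorff_measure n%:R A = 0%E -> null n (mdistR T) A.
Proof.
move=> HA e e0.
have c1 : hausdorff_content n%:R A 1 = 0%E.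
  apply/eqP; rewrite eq_le hausdorff_content_ge0 andbT.
  have cv := @nonincreasing_at_right_cvge R (hausdorff_content n%:R A) 0 +oo%O isT
     (fun a b _ _ ab => le_hausdorff_content n%:R A ab).
  rewrite -HA /hausdorff_measure (cvg_lim _ cv)//.
  by apply: ereal_sup_ubound; exists 1 => //=; rewrite in_itv /= ltr01.
have e0' : (0 < e%:E)%E by rewrite lte_fin.
have [_ [U [AU U1] <-] hU] : exists2 x, [set (\sum_(0 <= i <oo) (diam (U i) `^ n%:R))%E | U in
    [set U : nat -> set T | A `<=` \bigcup_i U i /\ forall i, (diam (U i) <= 1%:E)%E]] x
    & (x < e%:E)%E.
  by apply: ereal_inf_lt; rewrite -/(hausdorff_content n%:R A 1) c1.
have fU i : diam (U i) \is a fin_num.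
  by rewrite ge0_fin_numE ?diam_ge0// (le_lt_trans (U1 i))// ltry.
have fU0 i : 0 <= fine (diam (U i)) by rewrite fine_ge0// diam_ge0.
exists U, (fun i => fine (diam (U i))); split => //.
  by move=> i x y Ux Uy; rewrite -lee_fin fineK//; exact: mdist_le_diam.
move=> N; rewrite -lee_fin; apply: le_trans (ltW hU).
have -> : (\sum_(i < N) fine (diam (U i)) ^+ n)%:E =
    (\sum_(0 <= i < N) (diam (U i) `^ n%:R))%E.
  rewrite big_mkord -sumEFin; apply: eq_bigr => i _.
  by rewrite -[diam _]fineK// poweR_EFin powR_mulrn.
by apply: nneseries_lim_ge => i _ _; exact: poweR_ge0.
Qed.

Lemma hausdorff_measure_of_null (T : metricType R) (A : set T) :
  null n (mdistR T) A -> hausdorff_measure n%:R A = 0%E.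
Proof.
move=> nA.
have c0 del : 0 < del -> hausdorff_content n%:R A del = 0%E.
  move=> del0; apply/eqP; rewrite eq_le hausdorff_content_ge0 andbT.
  apply/lee_addgt0Pr => e e0; rewrite add0e.
  (* A total below [del ^+ n] forces each single [r i] below [del]. *)
  pose e' := Num.min e (del ^+ n).
  have e'0 : 0 < e' by rewrite lt_min e0 exprn_gt0.
  have [U [r [r0 dU AU sr]]] := nA _ e'0.
  have Ur i : (diam (U i) <= (r i)%:E)%E by apply: diam_le => // x y; exact: dU.
  apply: ge_ereal_inf; exists (\sum_(0 <= i <oo) (diam (U i) `^ n%:R))%E; last first.
    apply: lime_le; first by apply: is_cvg_nneseries => i _ _; exact: poweR_ge0.
    apply: nearW => N; apply: le_trans (_ : (\sum_(i < N) r i ^+ n)%:E <= _)%E; last first.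
      by rewrite lee_fin; apply: le_trans (sr N) _; rewrite ge_min lexx.
    rewrite big_mkord -sumEFin; apply: lee_sum => i _.
    rewrite -powR_mulrn// -poweR_EFin; apply: gt0_ler_poweR => //.
      by rewrite in_itv /= diam_ge0 leey.
    by rewrite in_itv /= lee_fin r0 leey.
  exists U => //; split => // i; apply: le_trans (Ur i) _; rewrite lee_fin.
  rewrite -(ler_pXn2r n_gt0) ?nnegrE ?r0 ?(ltW del0)//.
  apply: le_trans (_ : e' <= _); last by rewrite ge_min lexx orbT.
  apply: le_trans (sr i.+1); rewrite big_ord_recr /= lerDr sumr_ge0// => j _.
  by rewrite exprn_ge0.
rewrite /hausdorff_measure; apply: cvg_lim => //.
apply: cvg_near_cst; near=> del; apply: c0; near: del; exact: nbhs_right_gt.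
Unshelve. all: by end_near. Qed.

Lemma bounded_packing_of_finite_content (T : metricType R) :
  finite_packing_content n%:R T ->
  exists M, bounded_packing n (mdistR T) [set: T] M.
Proof.
move=> [M [M0 hM]]; exists M => s r us rs sep.
case: s us rs sep => [|x0 s0]; first by rewrite big_nil ltW.
set s := x0 :: s0 => us rs sep.
pose c i := nth x0 s i.
have cs i : (i < size s)%N -> c i \in s by move=> ?; exact: mem_nth.
have tI : trivIset [set i | (i < size s)%N] (fun i => cball (c i) (r (c i))).
  move=> i j /= si sj [z [zi zj]]; apply: contrapT => ij.
  apply: (sep (c i) (c j) z) => //; try exact: cs.
  by rewrite nth_uniq//; apply/eqP.
have := hM [set i | (i < size s)%N] c (fun i => r (c i)) _ tI.
have hr i : (i < size s)%N -> 0 < r (c i) /\ ((r (c i))%:E <= diam [set: T])%E.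
  move=> /cs /rs[_ r0 [p [q [_ _ pq]]]]; split => //.
  apply: le_trans (_ : (mdist p q)%:E <= _)%E; first by rewrite lee_fin.
  exact: mdist_le_diam.
move=> /(_ hr)/ltW; rewrite -lee_fin; apply: le_trans.
rewrite esum_fset.
- rewrite -[[set i | _]]/(`I_(size s)) -fsbig_ord.
  rewrite (big_nth x0) big_mkord sumEFin lee_fin le_eqVlt; apply/orP; left; apply/eqP.
  apply: eq_bigr => i _; rewrite powR_mulrn//.
  by have [/ltW] := hr i (ltn_ord i).
- exact: finite_II.
- by move=> i _; rewrite lee_fin powR_ge0.
Qed.

End hausdorff_null.

(** * Tangents *)

Section tangents.
Context (R : realType).

Lemma small_factor (a b : R) : 0 < a -> 0 < b ->
  exists e : R, [/\ 0 < e, e <= 1 & e * a <= b].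
Proof.
move=> a0 b0; exists (Num.min 1 (b / a)); split.
- by rewrite lt_min ltr01 divr_gt0.
- by rewrite ge_min lexx.
- by rewrite -ler_pdivlMr// ge_min lexx orbT.
Qed.

Lemma excess_le (Z : metricType R) (A B : set Z) (e : R) : 0 <= e ->
  (forall a, A a -> exists2 b, B b & mdist a b <= e) -> (excess A B <= e%:E)%E.
Proof.
move=> e0 h; rewrite /excess ge_max lee_fin e0 /=; apply: ge_ereal_sup.
move=> _ [a Aa <-]; have [b Bb ab] := h a Aa.
by apply: ge_ereal_inf; exists (mdist a b)%:E; [exists b|rewrite lee_fin].
Qed.

Lemma excess_lt (Z : metricType R) (A B : set Z) (e : R) :
  (excess A B < e%:E)%E -> forall a, A a -> exists2 b, B b & mdist a b < e.
Proof.
move=> h a Aa.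
have : (ereal_inf [set (mdist a b)%:E | b in B] < e%:E)%E.
  apply: le_lt_trans h; rewrite /excess le_max; apply/orP; right.
  by apply: ereal_sup_ubound; exists a.
by move=> /ereal_inf_lt[_ [b Bb <-]]; rewrite lte_fin; exists b.
Qed.

Lemma rel_dist_ge0 (Z : metricType R) (z : Z) r (A B : set Z) : 0 < r ->
  (0 <= rel_dist z r A B)%E.
Proof.
move=> r0; apply: mule_ge0; first by rewrite lee_fin invr_ge0 ltW.
by rewrite le_max /excess le_max lexx.
Qed.

Lemma rel_dist_le (Z : metricType R) (z : Z) r (A B : set Z) (e : R) :
  0 < r -> 0 <= e ->
  (forall a, A a -> mdist z a <= r -> exists2 b, B b & mdist a b <= e) ->
  (forall b, B b -> mdist z b <= r -> exists2 a, A a & mdist b a <= e) ->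
  (rel_dist z r A B <= (r^-1 * e)%:E)%E.
Proof.
move=> r0 e0 h1 h2; rewrite /rel_dist EFinM lee_pmul2l ?lte_fin ?invr_gt0//.
rewrite ge_max; apply/andP; split; apply: excess_le => // a [Aa za].
  exact: h1.
exact: h2.
Qed.

Lemma rel_dist_lt (Z : metricType R) (z : Z) r (A B : set Z) (e : R) :
  0 < r -> (rel_dist z r A B < (r^-1 * e)%:E)%E ->
  (forall a, A a -> mdist z a <= r -> exists2 b, B b & mdist a b < e) /\
  (forall b, B b -> mdist z b <= r -> exists2 a, A a & mdist b a < e).
Proof.
move=> r0; rewrite /rel_dist EFinM lte_pmul2l ?lte_fin ?invr_gt0//.
rewrite gt_max => /andP[h1 h2].
by split=> [a Aa za|b Bb zb]; [apply: (excess_lt h1)|apply: (excess_lt h2)].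
Qed.

Lemma closed_mdist (Z : metricType R) (A : set Z) x : closed A ->
  (forall e : R, 0 < e -> exists2 a, A a & mdist x a <= e) -> A x.
Proof.
move=> cA h; apply: cA => B /nbhs_ballP[e /= e0 eB].
have [a Aa xa] := h (e / 2) ltac:(by rewrite divr_gt0).
exists a; split => //; apply: eB; rewrite ballEmdist /=.
by apply: le_lt_trans xa _; rewrite ltr_pdivrMr// ltr_pMr// ltr1n.
Qed.

Lemma cvge0P (u : nat -> \bar R) : (forall i, (0 <= u i)%E) ->
  u @ \oo --> 0%E <->
  (forall e : R, 0 < e -> exists N, forall i, (N <= i)%N -> (u i < e%:E)%E).
Proof.
move=> u0; split=> [/fine_cvgP[[N1 _ hN1]]|h].
  move=> /cvgrPdist_lt h e e0; have [N2 _ hN2] := h e e0.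
  exists (maxn N1 N2) => i; rewrite geq_max => /andP[/hN1 /= f1 /hN2 /=].
  rewrite -(fineK f1) lte_fin sub0r normrN ger0_norm//.
  by rewrite fineK// fine_ge0.
suff : u @ \oo --> (0 : R)%:E by [].
apply/fine_cvgP; split.
  have [N hN] := h 1 ltr01; exists N => // i /= /hN h1.
  by rewrite ge0_fin_numE// (lt_trans h1)// ltry.
apply/cvgrPdist_lt => e e0; have [N hN] := h e e0; exists N => // i /= /hN h1.
have f1 : u i \is a fin_num by rewrite ge0_fin_numE// (lt_trans h1)// ltry.
rewrite sub0r normrN ger0_norm ?fine_ge0//.
by rewrite -lte_fin fineK.
Qed.

Context (d : nat).
Local Notation X := (euclid R d).

(** The approximation holds for all small [r], not along one sequence. Any other tangent is close to
    the same blow-ups at some scale, so it lies within every [e] of [T] and conversely, and both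
    sets are closed. *)
Lemma TanAW_of_limit (E : set X) (y : X) (T : set X) : closed T -> T 0 ->
  (forall rho e : R, 0 < rho -> 0 < e -> exists2 r0 : R, 0 < r0 &
     forall r, 0 < r -> r < r0 ->
     (forall a, blowup E y r a -> mdist (0 : X) a <= rho ->
        exists2 v, T v & mdist a v <= e) /\
     (forall v, T v -> mdist (0 : X) v <= rho ->
        exists2 a, blowup E y r a & mdist v a <= e)) ->
  TanAW E y = [set T].
Proof.
move=> cT T0 H; apply/seteqP; split=> [S [cS S0 [r [r_gt0 r_cvg rS]]]|_ ->].
  have ev rho e : 0 < rho -> 0 < e -> exists i,
     [/\ forall a, blowup E y (r i) a -> mdist (0 : X) a <= rho ->
            exists2 v, T v & mdist a v <= e,
         forall v, T v -> mdist (0 : X) v <= rho ->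
            exists2 a, blowup E y (r i) a & mdist v a <= e,
         forall a, blowup E y (r i) a -> mdist (0 : X) a <= rho ->
            exists2 v, S v & mdist a v < e &
         forall v, S v -> mdist (0 : X) v <= rho ->
            exists2 a, blowup E y (r i) a & mdist v a < e].
    move=> rho0 e0; have [r0 r00 hr0] := H rho e rho0 e0.
    have /cvgrPdist_lt/(_ _ r00)[N1 _ hN1] := r_cvg.
    have re0 : 0 < rho^-1 * e by rewrite mulr_gt0 ?invr_gt0.
    have rd0 j : (0 <= rel_dist (0%R : X) rho (blowup E y (r j)) S)%E.
      exact: rel_dist_ge0.
    have /(cvge0P rd0)/(_ _ re0)[N2 hN2] := rS rho rho0.
    pose i := maxn N1 N2; exists i.
    have := hN1 i (leq_maxl _ _); rewrite /= sub0r normrN gtr0_norm// => ri.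
    have [h1 h2] := hr0 _ (r_gt0 i) ri.
    have [h3 h4] := rel_dist_lt rho0 (hN2 i (leq_maxr _ _)).
    by split.
  have tri (a b c : X) : mdist a c <= mdist a b + mdist b c := metric_triangle a b c.
  rewrite /=; apply/seteqP; split=> t tS.
    apply: closed_mdist cT _ => e e0.
    pose e' := Num.min (e / 2) 1.
    have e'0 : 0 < e' by rewrite lt_min divr_gt0//=.
    have e'1 : e' <= 1 by rewrite ge_min lexx orbT.
    have e'2 : e' <= e / 2 by rewrite ge_min lexx.
    (* The extra 1 leaves room for the intermediate point of the blow-up, which is within [e' <= 1]
       of [t]. *)
    have rho0 : 0 < mdist (0 : X) t + 1 by rewrite ltr_wpDl// mdist_ge0.
    have [i [h1 _ _ h4]] := ev _ e' rho0 e'0.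
    have [a Ea ta] := h4 t tS ltac:(by rewrite lerDl).
    have [|v Tv av] := h1 a Ea.
      by apply: le_trans (tri _ t _) _; rewrite lerD2l ltW// (lt_le_trans ta).
    exists v => //; apply: le_trans (tri _ a _) _.
    by move: ta av e'2; clear; lra.
  apply: closed_mdist cS _ => e e0.
  pose e' := Num.min (e / 2) 1.
  have e'0 : 0 < e' by rewrite lt_min divr_gt0//=.
  have e'1 : e' <= 1 by rewrite ge_min lexx orbT.
  have e'2 : e' <= e / 2 by rewrite ge_min lexx.
  have rho0 : 0 < mdist (0 : X) t + 1 by rewrite ltr_wpDl// mdist_ge0.
  have [i [_ h2 h3 _]] := ev _ e' rho0 e'0.
  have [a Ea ta] := h2 t tS ltac:(by rewrite lerDl).
  have [|v Tv av] := h3 a Ea.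
    by apply: le_trans (tri _ t _) _; rewrite lerD2l (le_trans ta).
  exists v => //; apply: le_trans (tri _ a _) _.
  by move: ta av e'2; clear; lra.
split => //; exists (fun i => i.+1%:R^-1); split => [i||rho rho0].
- by rewrite invr_gt0.
- exact: cvg_harmonic.
- apply/cvge0P => [i|e e0]; first exact: rel_dist_ge0.
  have re0 : 0 < rho * (e / 2) by rewrite mulr_gt0// divr_gt0.
  have [r0 r00 hr0] := H rho _ rho0 re0.
  have [N hN] := ltr_add_invr r00; rewrite add0r in hN.
  exists N => i Ni.
  have ri : i.+1%:R^-1 < r0.
    by apply: le_lt_trans hN; rewrite lef_pV2 ?posrE// ler_nat.
  have [h1 h2] := hr0 i.+1%:R^-1 ltac:(by rewrite invr_gt0) ri.
  apply: le_lt_trans (rel_dist_le rho0 (ltW re0) h1 h2) _.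
  rewrite lte_fin mulKf ?gt_eqF//.
  by rewrite ltr_pdivrMr// ltr_pMr// ltr1n.
Qed.

End tangents.

Section tangent_of_piece.
Context (R : realType) (n d : nat).
Local Notation V := 'rV[R]_n.
Local Notation W := 'rV[R]_d.

(** A point of [E] near [F x] is close to some [F z] by density in [E]; the lower Lipschitz bound
    keeps [z] near [x], and the expansion applies. Conversely the right inverse [B] bounds [w] by
    [w *m D], density in the cube puts some [z] of [A] near [x + w], and [F z] is the point
    sought. *)
Lemma blowup_close_to_range (F : V -> W) (D : 'M[R]_(n, d)) (B : 'M[R]_(d, n))
    (A : set V) (E : set W) (x : V) (c : R) :
  has_differential F x D -> D *m B = 1%:M ->
  A `<=` @inner_box R n -> A x -> (forall z, A z -> E (F z)) -> 0 < c ->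
  (forall z, A z -> `|z - x| <= c * `|F z - F x|) ->
  dense_at (@sup_dist R n) (@unit_box R n) A x ->
  (forall e : R, 0 < e -> exists2 del, 0 < del & forall y, E y ->
     `|y - F x| < del -> exists2 z, A z & `|y - F z| <= e * `|y - F x|) ->
  forall rho e : R, 0 < rho -> 0 < e -> exists2 r0 : R, 0 < r0 &
    forall r, 0 < r -> r < r0 ->
    (forall y, E y -> `|y - F x| <= rho * r ->
       exists w : V, `|y - F x - w *m D| <= e * r) /\
    (forall w : V, `|w *m D| <= rho * r ->
       exists2 y, E y & `|y - F x - w *m D| <= e * r).
Proof.
move=> FD DB Ab Ax AE c0 Ac Ad Ed rho e rho0 e0.
have [CB CB0 hCB] := mulmx_norm_le B.
have [CD CD0 hCD] := mulmx_norm_le D.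
(* Each inclusion spends [e / 2] on density ([e1] in [E], [e3] in the cube) and [e / 2] on the
   expansion ([e2], [e4]). Below, the bound with [3^-1] keeps [x + w] in the unit box. *)
have e20 : 0 < e / 2 by rewrite divr_gt0.
have [e1 [e10 e11 he1]] := small_factor rho0 e20.
have [d1 d10 hd1] := Ed e1 e10.
have crho : 0 < 2 * c * rho by rewrite !mulr_gt0.
have [e2 [e2_gt0 _ he2]] := small_factor crho e20.
have [d2 d20 hd2] := FD e2 e2_gt0.
have CBrho : 0 < CB * rho by rewrite mulr_gt0.
have CDBrho : 0 < CD * (CB * rho) by rewrite mulr_gt0.
have [e3 [e30 e31 he3]] := small_factor CDBrho e20.
have [d3 d30 hd3] := Ad e3 e30.
have CB2rho : 0 < 2 * (CB * rho) by rewrite mulr_gt0.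
have [e4 [e40 _ he4]] := small_factor CB2rho e20.
have [d4 d40 hd4] := FD e4 e40.
exists (Num.min (d1 / rho) (Num.min (d2 / (2 * c * rho)) (Num.min (3^-1 / (CB * rho))
  (Num.min (d3 / (CB * rho)) (d4 / (2 * (CB * rho))))))).
  by rewrite !lt_min !divr_gt0// invr_gt0.
move=> r r_gt0; rewrite !lt_min !ltr_pdivlMr// => /and5P[r1 r2 r3 r4 r5].
split=> [y Ey yx|w wr].
  have [|z Az yz] := hd1 y Ey; first by apply: le_lt_trans yx _; rewrite mulrC.
  have FzFx : `|F z - F x| <= 2 * (rho * r).
    rewrite -(subrKA y) addrC -[y - _ + _]addrC.
    apply: le_trans (ler_normD _ _) _; rewrite [`|F z - y|]distrC.
    have : `|y - F z| <= rho * r.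
      by apply: le_trans yz _; apply: le_trans yx; rewrite ler_piMl.
    by move: yx; clear; lra.
  have zx : `|z - x| <= 2 * c * rho * r.
    apply: le_trans (Ac z Az) _.
    by rewrite (_ : 2 * c * rho * r = c * (2 * (rho * r))) ?ler_pM2l//; ring.
  exists (z - x).
  rewrite (_ : y - F x - _ = (y - F z) + (F z - F x - (z - x) *m D)); last first.
    by rewrite !addrA subrK.
  apply: le_trans (ler_normD _ _) _.
  rewrite (_ : e * r = e / 2 * r + e / 2 * r); last by field.
  apply: lerD.
    apply: le_trans yz _; apply: le_trans (_ : e1 * (rho * r) <= _).
      by rewrite ler_pM2l.
    by rewrite mulrA ler_pM2r.
  apply: le_trans (hd2 z (le_lt_trans zx _)) _; first by rewrite mulrC.
  apply: le_trans (_ : e2 * (2 * c * rho * r) <= _); first by rewrite ler_pM2l.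
  by rewrite mulrA ler_pM2r.
have wB : `|w| <= CB * rho * r.
  have -> : w = w *m D *m B by rewrite -mulmxA DB mulmx1.
  by apply: le_trans (hCB _) _; rewrite -mulrA ler_pM2l.
have xwb : unit_box (x + w).
  move=> i; have /andP[] := Ab _ Ax i; have := coord_norm_le w i.
  rewrite mxE ler_norml; have : `|w| < 3^-1 by apply: le_lt_trans wB _; rewrite mulrC.
  by clear => ? /andP[? ?] ? ?; apply/andP; split; lra.
have xxw : sup_dist x (x + w) = `|w| by rewrite /sup_dist opprD addrA subrr sub0r normrN.
have [|z Az xz] := hd3 _ xwb.
  by rewrite xxw; apply: le_lt_trans wB _; rewrite mulrC.
rewrite xxw {1}/sup_dist in xz.
have zx : `|z - x| <= 2 * (CB * rho) * r.
  rewrite (_ : z - x = w - (x + w - z)); last first.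
    by apply/rowP => i; rewrite !mxE; ring.
  apply: le_trans (ler_normB _ _) _.
  have : `|x + w - z| <= `|w| by apply: le_trans xz _; rewrite ler_piMl.
  by move: wB; clear; lra.
exists (F z); first exact: AE.
rewrite (_ : F z - F x - _ = (F z - F x - (z - x) *m D) - (x + w - z) *m D); last first.
  rewrite [(z - x) *m D]mulmxBl [(x + w - z) *m D]mulmxBl mulmxDl.
  move: (z *m D) (x *m D) (w *m D) (F z) (F x) => a b a' b' c'.
  by apply/rowP => i; rewrite !mxE; ring.
apply: le_trans (ler_normB _ _) _.
rewrite (_ : e * r = e / 2 * r + e / 2 * r); last by field.
apply: lerD.
  apply: le_trans (hd4 z (le_lt_trans zx _)) _; first by rewrite mulrC.
  apply: le_trans (_ : e4 * (2 * (CB * rho) * r) <= _); first by rewrite ler_pM2l.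
  by rewrite mulrA ler_pM2r.
apply: le_trans (hCD _) _.
apply: le_trans (_ : CD * (e3 * (CB * rho * r)) <= _).
  by rewrite ler_pM2l//; apply: le_trans xz _; rewrite ler_pM2l.
rewrite (_ : CD * _ = e3 * (CD * (CB * rho)) * r); last by ring.
by rewrite ler_pM2r.
Qed.

End tangent_of_piece.

Section euclidean_norm.
Context (R : realType) (d : nat).
Local Notation W := 'rV[R]_d.

Lemma norm_le_eucl_dist (a b : euclid R d) : `|(a : W) - b| <= eucl_dist a b.
Proof.
apply: norm_row_le => [|i]; first exact: sqrtr_ge0.
rewrite !mxE -sqrtr_sqr ler_wsqrtr// (bigD1 i)//= lerDl sumr_ge0// => j _.
exact: sqr_ge0.
Qed.

Lemma eucl_dist_le_norm (a b : euclid R d) : eucl_dist a b <= d%:R * `|(a : W) - b|.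
Proof.
rewrite -[leRHS]ger0_norm ?mulr_ge0// -sqrtr_sqr ler_wsqrtr//.
apply: le_trans (_ : \sum_(i < d) `|(a : W) - b| ^+ 2 <= _).
  apply: ler_sum => i _; rewrite -real_normK ?num_real// lerXn2r ?nnegrE//.
  by have := coord_norm_le ((a : W) - b) i; rewrite !mxE.
rewrite sumr_const card_ord -[leLHS]mulr_natl exprMn ler_wpM2r ?sqr_ge0//.
by rewrite -natrX ler_nat; case: (d) => // k; rewrite expnS expn1 leq_pmulr.
Qed.

End euclidean_norm.

Section range_of_matrix.
Context (R : realType) (n d : nat) (D : 'M[R]_(n, d)).

Definition range_mx : {vspace 'rV[R]_d} := limg (linfun (mulmxr D : 'rV_n -> 'rV_d)).

Lemma range_mxP (v : 'rV[R]_d) : v \in range_mx <-> exists w : 'rV[R]_n, v = w *m D.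
Proof.
split=> [/memv_imgP[w _ ->]|[w ->]]; first by exists w; rewrite lfunE.
by apply/memv_imgP; exists w; rewrite ?memvf// lfunE.
Qed.

Lemma dim_range_mx (B : 'M[R]_(d, n)) : D *m B = 1%:M -> \dim range_mx = n.
Proof.
move=> DB; rewrite /range_mx; set f := linfun _.
have f0 : lker f == 0%VS.
  apply/lker0P => u v; rewrite !lfunE /= => uv.
  by rewrite -[u]mulmx1 -[v]mulmx1 -DB !mulmxA uv.
rewrite limg_dim_eq ?(eqP f0) ?capv0// dimvf.
by rewrite dim_matrix; exact: mul1n.
Qed.

End range_of_matrix.

(** * Tangent planes almost everywhere on a Lipschitz piece *)

Section rectifiable_pieces.
Context (R : realType).

Definition has_tangent_plane (n d : nat) (E : set (euclid R d)) (y : euclid R d) :=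
  exists V : {vspace euclid R d},
    \dim V = n /\ TanAW E y = [set [set v | v \in V]].

(** The packing bound concerns balls of [E], so the density principle is applied in [submetric E],
    and the null set is carried out by [val], which preserves distances. *)
Lemma null_not_dense_in_set (n d : nat) (n_gt0 : (0 < n)%N) (E S : set (euclid R d)) (M : R) :
  bounded_packing n (@mdist R (submetric E)) [set: submetric E] M -> S `<=` E ->
  null n (@eucl_dist R d) [set y | S y /\ ~ dense_at (@eucl_dist R d) E S y].
Proof.
move=> pM SE; pose F : set (submetric E) := [set p | S (val p)].
have nF : null n (@mdist R (submetric E)) [set p | F p /\
    ~ dense_at (@mdist R (submetric E)) [set: submetric E] F p].
  apply: (@null_not_dense_at _ n n_gt0 _ _ _ _ _ _ _ _ M) => //.
  - by move=> x; exact: mdistxx.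
  - by move=> x y; exact: mdist_ge0.
  - by move=> x y; exact: metric_sym.
  - by move=> y x z; exact: metric_triangle.
have val_lip (p q : submetric E) : F p /\ ~ dense_at (@mdist R (submetric E)) setT F p ->
    F q /\ ~ dense_at (@mdist R (submetric E)) setT F q ->
    eucl_dist (val p) (val q) <= 1 * mdist p q by rewrite mul1r.
apply: (sub_null _ (null_image (@mdist_ge0 R (submetric E)) val_lip nF)) => y [Sy nd].
exists (exist _ y (mem_set (SE _ Sy))) => //; split => // ndp; apply: nd => e e0.
have [del del0 hdel] := ndp e e0; exists del => // z Ez yz.
have [[w wE] Fw zw] := hdel (exist _ z (mem_set Ez)) I yz.
by exists w.
Qed.

(** Carries [blowup_close_to_range] over to the Euclidean distance, which is at least the sup norm
    and at most [d] times it. *)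
Lemma tangent_plane_at (n d : nat) (hd : (0 < d)%N) (E : set (euclid R d))
    (F : 'rV[R]_n -> 'rV[R]_d) (D : 'M[R]_(n, d)) (B : 'M[R]_(d, n))
    (A : set 'rV[R]_n) (x : 'rV[R]_n) (c : R) :
  has_differential F x D -> D *m B = 1%:M ->
  A `<=` @inner_box R n -> A x -> F @` A `<=` E -> 0 < c ->
  (forall z, A z -> `|z - x| <= c * `|F z - F x|) ->
  dense_at (@sup_dist R n) (@unit_box R n) A x ->
  dense_at (@eucl_dist R d) E (F @` A) (F x) ->
  has_tangent_plane n E (F x).
Proof.
move=> FD DB Ab Ax AE c0 Ac Ad Ed.
have d0 : 0 < d%:R :> R by rewrite ltr0n.
exists (range_mx D : {vspace euclid R d}); split; first exact: dim_range_mx DB.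
set T : set (euclid R d) := [set v | _].
have TP v : T v <-> exists w : 'rV[R]_n, v = w *m D by exact: range_mxP.
(* The range of [D] is closed because it is the fixed set of the continuous projection [B *m D]. *)
have [CBD CBD0 hCBD] := mulmx_norm_le (B *m D).
have cT : closed T.
  move=> t tcl; apply/TP; exists (t *m B); apply/eqP.
  rewrite -subr_eq0 -normr_eq0 eq_le normr_ge0 andbT; apply/ler_addgt0Pl => e e0.
  rewrite addr0.
  have e'0 : 0 < e / (CBD + 1) by rewrite divr_gt0// addr_gt0.
  have [v [/TP[w vw]]] := tcl _ (nbhsx_ballx t _ e'0).
  rewrite ballEmdist /= => tv.
  have ntv : `|(t : 'rV[R]_d) - v| <= e / (CBD + 1).
    by apply: le_trans (norm_le_eucl_dist t v) _; exact: ltW.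
  rewrite (_ : _ - _ = (t - v) - (t - v) *m (B *m D) :> 'rV[R]_d); last first.
    have vE : (v : 'rV[R]_d) *m (B *m D) = v by rewrite vw mulmxA -(mulmxA w D B) DB mulmx1.
    rewrite [((t : 'rV[R]_d) - v) *m _]mulmxBl vE mulmxA.
    by move: (t *m B *m D) => u; apply/rowP => i; rewrite !mxE; ring.
  apply: le_trans (ler_normB _ _) _.
  apply: le_trans (lerD (lexx _) (hCBD _)) _.
  by move: ntv; rewrite ler_pdivlMr ?addr_gt0// mulrDr mulr1 addrC [X in _ + X <= _]mulrC.
apply: TanAW_of_limit => //; first by apply/TP; exists 0; rewrite mul0mx.
move=> rho e rho0 e0.
have ed0 : 0 < e / d%:R by rewrite divr_gt0.
have AE' z : A z -> E (F z) by move=> Az; apply: AE; exists z.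
have Ed' : forall e : R, 0 < e -> exists2 del, 0 < del & forall y : 'rV[R]_d, E y ->
     `|y - F x| < del -> exists2 z, A z & `|y - F z| <= e * `|y - F x|.
  move=> a a0; have ad0 : 0 < a / d%:R by rewrite divr_gt0.
  have [del del0 hdel] := Ed _ ad0; exists (del / d%:R); first by rewrite divr_gt0.
  move=> y Ey yx.
  have xy : eucl_dist (F x) y <= d%:R * `|y - F x|.
    by rewrite [`|_|]distrC; exact: (@eucl_dist_le_norm R d).
  have [|_ [z Az <-] yz] := hdel y Ey.
    by apply: le_lt_trans xy _; rewrite mulrC -ltr_pdivlMr.
  exists z => //; apply: le_trans (@norm_le_eucl_dist R d y (F z)) _.
  apply: le_trans yz _; rewrite -mulrA ler_pM2l// mulrC ler_pdivrMr// mulrC.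
  by [].
have [r0 r00 hr0] := blowup_close_to_range FD DB Ab Ax AE' c0 Ac Ad Ed' rho0 ed0.
exists r0 => // r r_gt0 rr0; have [h1 h2] := hr0 r r_gt0 rr0.
have r'0 : 0 < r^-1 by rewrite invr_gt0.
have scale (u v : 'rV[R]_d) : `|u - v| <= e / d%:R * r ->
    eucl_dist (r^-1 *: u : euclid R d) (r^-1 *: v) <= e.
  move=> uv; apply: le_trans (@eucl_dist_le_norm R d _ _) _.
  rewrite -scalerBr normrZ gtr0_norm// mulrCA ler_pdivrMl//.
  rewrite mulrC -ler_pdivlMr//; apply: le_trans uv _.
  by rewrite mulrAC [r * e]mulrC.
have rK (u : 'rV[R]_d) : r^-1 *: (r *: u) = u by rewrite scalerA mulVf ?scale1r// gt_eqF.
split=> [a [y Ey <-] ay|v /TP[w vw] vrho].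
  have yx : `|(y : 'rV[R]_d) - F x| <= rho * r.
    have := le_trans (@norm_le_eucl_dist R d 0 (r^-1 *: (y - F x))) ay.
    by rewrite sub0r normrN normrZ gtr0_norm// mulrC ler_pdivrMr.
  have [w hw] := h1 y Ey yx.
  exists (r^-1 *: (w *m D) : 'rV[R]_d); first by apply/TP; exists (r^-1 *: w); rewrite scalemxAl.
  exact: scale.
have wr : `|(r *: w) *m D| <= rho * r.
  rewrite -scalemxAl normrZ gtr0_norm// mulrC ler_pM2r//.
  have := le_trans (@norm_le_eucl_dist R d 0 v) vrho.
  by rewrite sub0r normrN vw.
have [y Ey yw] := h2 _ wr.
exists (r^-1 *: ((y : 'rV[R]_d) - F x)); first by exists y.
rewrite vw -[X in mdist X _]rK metric_sym scalemxAl.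
exact: scale.
Qed.

Lemma null_eucl_of_null_sup (n d : nat) (A : set 'rV[R]_d) :
  null n (@sup_dist R d) A -> null n (@eucl_dist R d) A.
Proof.
move=> nA; rewrite -[A]image_id.
apply: (@null_image _ n _ _ (@sup_dist R d) (@eucl_dist R d) id d%:R) => //.
- by move=> x y; exact: normr_ge0.
- by move=> x y _ _; exact: (@eucl_dist_le_norm R d).
Qed.

(** Four null sets of values are discarded: those of points without differential, critical values,
    and, for each of countably many pieces [Ak ku], the values of points where the piece is not
    dense in the cube and those where its image is not dense in [E]. *)
Lemma null_no_tangent_plane (n d : nat) (hd : (0 < d)%N) (E : set (euclid R d)) (M : R)
    (F : 'rV[R]_n.+1 -> 'rV[R]_d) (L : R) (A : set 'rV[R]_n.+1) :
  bounded_packing n.+1 (@mdist R (submetric E)) [set: submetric E] M ->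
  0 <= L -> (forall x y, `|F x - F y| <= L * `|x - y|) ->
  A `<=` @inner_box R n.+1 -> F @` A `<=` E ->
  null n.+1 (@eucl_dist R d) [set y | (F @` A) y /\ ~ has_tangent_plane n.+1 E y].
Proof.
move=> pM L0 FL Ab AE.
pose N0 : set 'rV[R]_n.+1 := [set x | inner_box x /\ ~ exists D, has_differential F x D].
pose S1 : set 'rV[R]_n.+1 := [set x | unit_box x /\
    exists D, has_differential F x D /\ exists2 w : 'rV[R]_n.+1, w != 0 & w *m D = 0].
(* The lower bound holds only near each point; confining a piece to one dyadic cube of side less
   than that radius makes it valid between any two of its points. *)
pose Ak (ku : nat * seq {ffun 'I_n.+1 -> bool}) : set 'rV[R]_n.+1 :=
  [set x | [/\ A x, address x (size ku.2) = ku.2, 2^-1 ^+ size ku.2 < ku.1.+1%:R^-1 :> R &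
    forall z, A z -> `|z - x| < ku.1.+1%:R^-1 -> `|z - x| <= ku.1.+1%:R * `|F z - F x|]].
have Fnull B : null n.+1 (@sup_dist R n.+1) B -> null n.+1 (@eucl_dist R d) (F @` B).
  move=> nB; apply: null_eucl_of_null_sup => //.
  apply: (null_image (L := L) _ _ nB) => x y; first exact: normr_ge0.
  by move=> _ _; exact: FL.
have AkA ku : Ak ku `<=` A by move=> x [].
have Ab' := inner_box_sub_unit_box.
have n0 : null n.+1 (@eucl_dist R d) (F @` N0).
  by apply: Fnull; apply: rademacher_vector FL.
have n1 : null n.+1 (@eucl_dist R d) (F @` S1).
  by apply: null_eucl_of_null_sup => //; exact: null_critical_values FL.
have n2 ku : null n.+1 (@eucl_dist R d)
   (F @` [set x | Ak ku x /\ ~ dense_at (@sup_dist R n.+1) (@unit_box R n.+1) (Ak ku) x]).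
  by apply: Fnull; apply: null_not_dense_in_unit_box => // x /AkA/Ab/Ab'.
have n3 ku : null n.+1 (@eucl_dist R d)
   [set y | (F @` Ak ku) y /\ ~ dense_at (@eucl_dist R d) E (F @` Ak ku) y].
  apply: null_not_dense_in_set pM _ => //.
  by move=> _ [x /AkA Ax <-]; apply: AE; exists x.
have lt0 : (0 < n.+1)%N by [].
apply: sub_null (nullU lt0 (nullU lt0 n0 n1) (nullU lt0 (null_bigcup_countType lt0 n2)
  (null_bigcup_countType lt0 n3))).
move=> _ [[x Ax <-] ntan].
have xi := Ab _ Ax; have xb := Ab' _ _ _ xi.
apply: contrapT => /not_orP[/not_orP[h0 h1] /not_orP[h2 h3]].
have [D FD] : exists D, has_differential F x D.
  by apply: contrapT => h; apply: h0; exists x.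
have Dfree : row_free D.
  rewrite -kermx_eq0; apply: contrapT => /negP/rowV0Pn[w /sub_kermxP wD w0].
  by apply: h1; exists x => //; split => //; exists D; split => //; exists w.
have [B DB] := row_freeP Dfree.
have [CB CB0 hCB] := mulmx_norm_le B.
(* With this error, half of the norm of [z - x] is absorbed, which leaves the lower bound with
   constant [2 * CB]. *)
have e0 : 0 < (2 * CB)^-1 by rewrite invr_gt0 mulr_gt0.
have [del del0 hdel] := FD _ e0.
have expand z : `|z - x| < del -> `|z - x| <= 2 * CB * `|F z - F x|.
  move=> zx; have := hdel z zx; set w := z - x.
  have wB : `|w| <= CB * `|w *m D| by rewrite -{1}[w]mulmx1 -DB mulmxA.
  have : `|w *m D| <= `|F z - F x| + `|F z - F x - w *m D|.
    by rewrite -{1}[w *m D](subKr (F z - F x)); exact: ler_normB.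
  move: `|w| `|w *m D| `|F z - F x| `|_ - _ *m _| wB => a b c g ab bc ga.
  have ga' : CB * g <= a / 2.
    apply: le_trans (ler_wpM2l (ltW CB0) ga) _.
    by rewrite le_eqVlt; apply/orP; left; apply/eqP; field; rewrite gt_eqF.
  have : CB * b <= CB * c + CB * g by rewrite -mulrDr ler_pM2l.
  by move: ab ga'; clear; lra.
have [k [kdel kCB]] : exists k : nat, k.+1%:R^-1 < del /\ 2 * CB <= k.+1%:R :> R.
  have [k1 hk1] := ltr_add_invr del0; rewrite add0r in hk1.
  pose k2 := Num.truncn (2 * CB).
  exists (maxn k1 k2); split.
    by apply: le_lt_trans hk1; rewrite lef_pV2 ?posrE// ler_nat ltnS leq_maxl.
  apply: le_trans (ltW (truncnS_gt _)) _.
  by rewrite ler_nat ltnS leq_maxr.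
have k0 : 0 < k.+1%:R^-1 :> R by rewrite invr_gt0.
have [m hm] : exists m, 2^-1 ^+ m < k.+1%:R^-1 :> R.
  exists k.+1; rewrite exprVn ltf_pV2 ?posrE ?exprn_gt0// -natrX ltr_nat.
  exact: ltn_expl.
pose ku := (k, address x m).
have Akx : Ak ku x.
  split => //=; rewrite ?size_address//.
  move=> z Az zx; apply: le_trans (expand z (lt_trans zx kdel)) _.
  by rewrite ler_wpM2r.
apply: ntan.
apply: (@tangent_plane_at _ _ hd E F D B (Ak ku) x k.+1%:R FD DB) => //.
- by move=> z /AkA/Ab.
- by move=> _ [z /AkA Az <-]; apply: AE; exists z.
- move=> z [Az za zm _]; have [_ _ _ hx] := Akx; apply: hx => //.
  apply: le_lt_trans zm; apply: address_eq_dist => //; first exact/Ab'/Ab.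
  by rewrite za size_address.
- by apply: contrapT => h; apply: h2; exists ku => //; exists x.
- by apply: contrapT => h; apply: h3; exists ku => //; split => //; exists x.
Qed.

End rectifiable_pieces.

(* The domain is shrunk into [inner_box] so that small balls around its points
   stay inside the unit box, where the dyadic cubes live. *)
Lemma exists_lipschitz_parametrisation (R : realType) (n d : nat) (E : set (euclid R d))
    (S : set (euclid R n)) (f : submetric S -> submetric E) :
  S `<=` @unit_cube R n -> lipschitz_map f ->
  exists (F : 'rV[R]_n -> 'rV[R]_d) (L : R) (A : set 'rV[R]_n),
    [/\ 0 <= L, forall x y, `|F x - F y| <= L * `|x - y|, A `<=` @inner_box R n &
        F @` A = val @` range f].
Proof.
move=> Scube [L fL].
pose g (l : 'I_d) (x : 'rV[R]_n) : R :=
  if pselect ((x : euclid R n) \in S) is left xS then (val (f (exist _ x xS)) : 'rV[R]_d) ord0 l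
  else 0.
pose K : R := `|L| * n%:R.
have K0 : 0 <= K by rewrite mulr_ge0.
have gE l x (xS : (x : euclid R n) \in S) :
    g l x = (val (f (exist _ x xS)) : 'rV[R]_d) ord0 l.
  by rewrite /g; case: pselect => // h; rewrite (bool_irrelevance h xS).
have gL l x y : S x -> S y -> `|g l x - g l y| <= K * `|x - y|.
  move=> /mem_set xS /mem_set yS; rewrite (gE l x xS) (gE l y yS).
  set p := f _; set q := f _.
  apply: le_trans (_ : `|(val p : 'rV[R]_d) - val q| <= _).
    by have := coord_norm_le ((val p : 'rV[R]_d) - val q) l; rewrite !mxE.
  apply: le_trans (norm_le_eucl_dist _ _) _.
  apply: le_trans (fL _ _) _; apply: le_trans (_ : `|L| * eucl_dist (x : euclid R n) y <= _).
    by rewrite ler_wpM2r ?mdist_ge0// ler_norm.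
  by rewrite /K -mulrA ler_wpM2l// eucl_dist_le_norm.
have /choice[G hG] l := lipschitz_extension K0 (gL l).
(* Sends each interval from 1/3 to 2/3 onto the interval from 0 to 1, hence the inner box onto the
   unit cube. *)
pose sc (x : 'rV[R]_n) : 'rV[R]_n := 3 *: x - const_mx 1.
exists (fun x => \row_l G l (sc x)), (K * 3), [set x | S (sc x)]; split.
- by rewrite mulr_ge0.
- move=> x y; apply: norm_row_le => [|l]; first by rewrite !mulr_ge0.
  rewrite !mxE; have [h _] := hG l; apply: le_trans (h _ _) _.
  rewrite /sc opprB addrA subrK -scalerBr normrZ -mulrA ger0_norm//.
- move=> x /= /Scube xc i; have := xc i; rewrite /sc !mxE => /andP[? ?].
  by apply/andP; split; lra.
- apply/seteqP; split=> [_ [x /= Sx <-]|_ [_ [[z zS] _ <-] <-]].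
    exists (f (exist _ (sc x) (mem_set Sx))); first by eexists.
    apply/rowP => l; rewrite mxE; have [_ ->//] := hG l; exact/esym/gE.
  have scz : sc (3^-1 *: ((z : 'rV[R]_n) + const_mx 1)) = z.
    by rewrite /sc scalerA mulfV// scale1r addrK.
  exists (3^-1 *: ((z : 'rV[R]_n) + const_mx 1)) => /=; first by rewrite scz; exact: set_mem.
  apply/rowP => l; rewrite mxE scz; have [_ ->] := hG l; last exact: set_mem.
  exact: gE.
Qed.

Theorem theorem7p5 (R : realType) (n d : nat) (hn : (1 <= n)%N) (hd : (1 <= d)%N)
    (E : set (euclid R d))
    (E_rect : rectifiable n (submetric E))
    (E_pack : finite_packing_content n%:R (submetric E)) :
  hausdorff_measure n%:R
    [set x | E x /\
       ~ exists V : {vspace euclid R d},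
           \dim V = n /\ TanAW E x = [set [set v | v \in V]]] = 0%E.
Proof.
case: n hn E_rect E_pack => // n' _ [Es [f [Ecube fL Efull]]] Epack.
have n0 : (0 < n'.+1)%N by [].
have [M pM] := bounded_packing_of_finite_content Epack.
have /choice[F hF] i := exists_lipschitz_parametrisation (Ecube i) (fL i).
have /choice[L hL] i := hF i.
have /choice[A hA] i := hL i.
have nfull := null_of_hausdorff_measure Efull.
(* Points of [E] that no piece reaches are null in [submetric E], and remain so in the ambient space
   as [val] preserves distances. *)
have nrest : null n'.+1 (@eucl_dist R d) (val @` (~` \bigcup_i range (f i))).
  apply: (null_image (L := 1) (@mdist_ge0 R (submetric E)) _ nfull).
  by move=> p q _ _; rewrite mul1r.
have npiece i : null n'.+1 (@eucl_dist R d)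
    [set y | (F i @` A i) y /\ ~ has_tangent_plane n'.+1 E y].
  have [L0 FL Ab AE] := hA i.
  apply: (null_no_tangent_plane hd pM L0 FL Ab).
  by rewrite AE => _ [p _ <-]; apply: set_mem; exact: valP.
apply: hausdorff_measure_of_null => //.
apply: sub_null (nullU n0 nrest (null_bigcup n0 npiece)) => x [Ex ntan].
pose p : submetric E := exist _ x (mem_set Ex).
have [[i _ rp]|np] := pselect ((\bigcup_i range (f i)) p); last by left; exists p.
right; exists i => //; split => //; have [_ _ _ ->] := hA i.
by exists p.
Qed.
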